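(* Let $0<a\le b$ and let $\mathcal{T}_{a,b}$ be the right-angled triangle with vertices $(0,b)$, $(a,0)$, $(0,0)$. Put $c=\sqrt{a^2+b^2}$, $\alpha=\arctan(a/b)$, $u=a+b+c$, $\tilde A=ab/2$, $h=a\cos\alpha$. The distribution function $G$ of the distance $t$ between two random points (chosen independently and uniformly) in $\mathcal{T}_{a,b}$ is given by $$G(t)=\begin{cases}0 & \text{if } t<0,\\ \dfrac1{\tilde A}\left[t^2\left(\pi-\dfrac{2u}{3\tilde A}t\right)+\dfrac2{\tilde A}J^\natural(t)\right] & \text{if } 0\le t<c,\\ 1 & \text{if } t\ge c\end{cases}$$ with $$J^\natural(t)=\begin{cases}K_1(t) & \text{if } 0\le t<h,\\ K_1(h)+K_2(t) & \text{if } h\le t<a,\\ K_1(h)+K_2(a)+K_3(t) & \text{if } a\le t<b,\\ K_1(h)+K_2(a)+K_3(b)+K_4(t) & \text{if } b\le t<c,\end{cases}$$ where $$K_1(t)=J_1^\natural(0,t),$$ $$K_2(t)=\tfrac12(t^2-h^2)\,[J_1^*(0,h)-H_2^*(h)]+J_2^\natural(h,t),$$ $$K_3(t)=\tfrac12(t^2-a^2)\,[J_1^*(0,h)+J_2^*(h,a)-H_3^*(a)]+J_3^\natural(a,t),$$ $$K_4(t)=\tfrac12(t^2-b^2)\,[J_1^*(0,h)+J_2^*(h,a)+J_3^*(a,b)-H_4^*(b)]+J_4^\natural(b,t)$$ with $J_k^\natural(s,t)=H_k^\natural(t)-H_k^\natural(s)$, where $$H_1^\natural(t)=\frac{\Theta_1t^4}{32},$$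 $$H_2^\natural(t)=\frac{\Theta_2t^4}{32}+\Theta_3L_1^\natural(t,h)+c\,L_2^\natural(t,h),$$ $$H_3^\natural(t)=\frac{at^3}{3}+\frac{\Theta_4t^4}{8}+\frac{\Theta_3}{2}L_1^\natural(t,h)+\frac c2L_2^\natural(t,h)+\frac{b}{2a}L_1^\natural(t,a)+\frac b2L_2^\natural(t,a),$$ $$H_4^\natural(t)=\frac{\Theta_5t^3}{3}+\frac{\Theta_6t^4}{32}+\frac{b}{2a}L_1^\natural(t,a)+\frac b2L_2^\natural(t,a)+\frac{a}{2b}L_1^\natural(t,b)+\frac a2L_2^\natural(t,b)$$ with, for $t\ge x>0$, $$L_1^\natural(t,x)=\frac18\left[\frac{5x}{3}(t^2-x^2)^{3/2}+x^3\sqrt{t^2-x^2}+t^4\arcsin\frac xt\right],$$ $$L_2^\natural(t,x)=\frac13(t^2-x^2)^{3/2}+\frac x2\left(x\sqrt{t^2-x^2}+t^2\arcsin\frac xt\right).$$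
   Context: The constants $\Theta_1,\dots,\Theta_6$ are $$\Theta_1=\frac ab(2\alpha+\pi)+\frac{2b}{a}(\pi-\alpha)+6,\quad \Theta_2=\frac ab(2\alpha-\pi)-\frac{2b}{a}\alpha+6,\quad \Theta_3=\frac ab+\frac ba,$$ $$\Theta_4=1-\frac ba\alpha,\quad \Theta_5=a+b,\quad \Theta_6=\frac ab(2\alpha-\pi)-\frac{2b}{a}\alpha+2 .$$ The functions $J_k^*$ and $H_k^*$ are $J_k^*(s,t)=H_k^*(t)-H_k^*(s)$ with $$H_1^*(t)=\frac{\Theta_1t^2}{8},$$ $$H_2^*(t)=\frac{\Theta_2t^2}{8}+\Theta_3L_1^*(t,h)+c\,L_2^*(t,h),$$ $$H_3^*(t)=at+\frac{\Theta_4t^2}{2}+\frac{\Theta_3}{2}L_1^*(t,h)+\frac c2L_2^*(t,h)+\frac{b}{2a}L_1^*(t,a)+\frac b2L_2^*(t,a),$$ $$H_4^*(t)=\Theta_5t+\frac{\Theta_6t^2}{8}+\frac{b}{2a}L_1^*(t,a)+\frac b2L_2^*(t,a)+\frac{a}{2b}L_1^*(t,b)+\frac a2L_2^*(t,b),$$ where, for $t\ge x>0$, $$L_1^*(t,x)=\frac12\left(x\sqrt{t^2-x^2}+t^2\arcsin\frac xt\right),\qquad L_2^*(t,x)=\sqrt{t^2-x^2}+x\arcsin\frac xt .$$ The triangle $\mathcal{T}_{a,b}$ is understood as the closed convex set (with interior); $u$ is its perimeter, $\tilde A$ its area, $c$ its hypotenuse and $h$ its height over the hypotenuse. The two random points are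 independent and each is uniformly distributed in $\mathcal{T}_{a,b}$; $t$ is their Euclidean distance, and $G(t)$ is the probability that this distance is at most $t$. *)

(* Defs.v *)
From HB Require Import structures.
From mathcomp Require Import all_boot all_order all_algebra.
From mathcomp Require Import all_classical all_reals all_analysis.

Set Implicit Arguments.
Unset Strict Implicit.
Unset Printing Implicit Defensive.

Import Order.TTheory GRing.Theory Num.Theory.
Import numFieldNormedType.Exports.

Local Open Scope classical_set_scope.
Local Open Scope ring_scope.

(* [measurableTypeR R] is [R] with its Borel sigma-algebra; the product carries
   the product sigma-algebra. *)
Notation plane R := (measurableTypeR R * measurableTypeR R)%type.

Definition area_measure (R : realType) : set (plane R) -> \bar R :=
  (@lebesgue_measure R \x @lebesgue_measure R)%E.

(* The library norm on a product is the sup norm, hence this definition. *)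
Definition euclidean_dist (R : realType) (p q : plane R) : R :=
  Num.sqrt ((p.1 - q.1) ^+ 2 + (p.2 - q.2) ^+ 2).

(* The closed convex hull of three points, by barycentric coordinates. *)
Definition triangle (R : realType) (A B C : plane R) : set (plane R) :=
  [set p | exists l m n : R,
     [/\ 0 <= l, 0 <= m, 0 <= n, l + m + n = 1 &
         p = (l * A.1 + m * B.1 + n * C.1, l * A.2 + m * B.2 + n * C.2)]].

Definition right_triangle (R : realType) (a b : R) : set (plane R) :=
  triangle (0, b) (a, 0) (0, 0).

(* Meaningful when [T] is measurable with finite positive area. *)
Definition uniformly_distributed (R : realType) (d : measure_display)
    (Omega : measurableType d) (P : probability Omega R)
    (X : {RV P >-> plane R}) (T : set (plane R)) : Prop :=
  forall B : set (plane R), measurable B ->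
    distribution P X B =
    (fine (area_measure (B `&` T)) / fine (area_measure T))%:E.

Definition independent_points (R : realType) (d : measure_display)
    (Omega : measurableType d) (P : probability Omega R)
    (X Y : {RV P >-> plane R}) : Prop :=
  forall A B : set (plane R), measurable A -> measurable B ->
    (P (X @^-1` A `&` Y @^-1` B) = P (X @^-1` A) * P (Y @^-1` B))%E.

Definition distance_distribution (R : realType) (d : measure_display)
    (Omega : measurableType d) (P : probability Omega R)
    (X Y : {RV P >-> plane R}) (t : R) : \bar R :=
  P [set w | euclidean_dist (X w) (Y w) <= t].

Section auxiliary_functions.
Context {R : realType}.
Implicit Types t x : R.

(* [Lis] and [Lin] ([i] = 1, 2) stand for L_i^* and L_i^natural; likewise the
   suffixes [s] (star) and [n] (natural) of [H] and [J] below.  They are only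
   meaningful for [0 < x <= t]. *)
Definition L1s t x : R :=
  1 / 2 * (x * Num.sqrt (t ^+ 2 - x ^+ 2) + t ^+ 2 * asin (x / t)).

Definition L2s t x : R :=
  Num.sqrt (t ^+ 2 - x ^+ 2) + x * asin (x / t).

Definition L1n t x : R :=
  1 / 8 * (5 * x / 3 * (t ^+ 2 - x ^+ 2) `^ (3 / 2)
           + x ^+ 3 * Num.sqrt (t ^+ 2 - x ^+ 2)
           + t ^+ 4 * asin (x / t)).

Definition L2n t x : R :=
  1 / 3 * (t ^+ 2 - x ^+ 2) `^ (3 / 2)
  + x / 2 * (x * Num.sqrt (t ^+ 2 - x ^+ 2) + t ^+ 2 * asin (x / t)).

End auxiliary_functions.

Section triangle_constants.
Context {R : realType}.
Implicit Types (a b t s : R).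

Definition hypotenuse a b : R := Num.sqrt (a ^+ 2 + b ^+ 2).

Definition alpha a b : R := atan (a / b).

Definition perimeter a b : R := a + b + hypotenuse a b.

Definition area a b : R := a * b / 2.

Definition height a b : R := a * cos (alpha a b).

Definition Theta1 a b : R :=
  a / b * (2 * alpha a b + pi) + 2 * b / a * (pi - alpha a b) + 6.

Definition Theta2 a b : R :=
  a / b * (2 * alpha a b - pi) - 2 * b / a * alpha a b + 6.

Definition Theta3 a b : R := a / b + b / a.

Definition Theta4 a b : R := 1 - b / a * alpha a b.

Definition Theta5 a b : R := a + b.

Definition Theta6 a b : R :=
  a / b * (2 * alpha a b - pi) - 2 * b / a * alpha a b + 2.

Definition H1s a b t : R := Theta1 a b * t ^+ 2 / 8.

Definition H2s a b t : R :=
  Theta2 a b * t ^+ 2 / 8 + Theta3 a b * L1s t (height a b)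
  + hypotenuse a b * L2s t (height a b).

Definition H3s a b t : R :=
  a * t + Theta4 a b * t ^+ 2 / 2
  + Theta3 a b / 2 * L1s t (height a b)
  + hypotenuse a b / 2 * L2s t (height a b)
  + b / (2 * a) * L1s t a + b / 2 * L2s t a.

Definition H4s a b t : R :=
  Theta5 a b * t + Theta6 a b * t ^+ 2 / 8
  + b / (2 * a) * L1s t a + b / 2 * L2s t a
  + a / (2 * b) * L1s t b + a / 2 * L2s t b.

Definition J1s a b s t : R := H1s a b t - H1s a b s.
Definition J2s a b s t : R := H2s a b t - H2s a b s.
Definition J3s a b s t : R := H3s a b t - H3s a b s.

Definition H1n a b t : R := Theta1 a b * t ^+ 4 / 32.

Definition H2n a b t : R :=
  Theta2 a b * t ^+ 4 / 32 + Theta3 a b * L1n t (height a b)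
  + hypotenuse a b * L2n t (height a b).

Definition H3n a b t : R :=
  a * t ^+ 3 / 3 + Theta4 a b * t ^+ 4 / 8
  + Theta3 a b / 2 * L1n t (height a b)
  + hypotenuse a b / 2 * L2n t (height a b)
  + b / (2 * a) * L1n t a + b / 2 * L2n t a.

Definition H4n a b t : R :=
  Theta5 a b * t ^+ 3 / 3 + Theta6 a b * t ^+ 4 / 32
  + b / (2 * a) * L1n t a + b / 2 * L2n t a
  + a / (2 * b) * L1n t b + a / 2 * L2n t b.

Definition J1n a b s t : R := H1n a b t - H1n a b s.
Definition J2n a b s t : R := H2n a b t - H2n a b s.
Definition J3n a b s t : R := H3n a b t - H3n a b s.
Definition J4n a b s t : R := H4n a b t - H4n a b s.

Definition K1 a b t : R := J1n a b 0 t.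

Definition K2 a b t : R :=
  let h := height a b in
  1 / 2 * (t ^+ 2 - h ^+ 2) * (J1s a b 0 h - H2s a b h) + J2n a b h t.

Definition K3 a b t : R :=
  let h := height a b in
  1 / 2 * (t ^+ 2 - a ^+ 2) * (J1s a b 0 h + J2s a b h a - H3s a b a)
  + J3n a b a t.

Definition K4 a b t : R :=
  let h := height a b in
  1 / 2 * (t ^+ 2 - b ^+ 2)
    * (J1s a b 0 h + J2s a b h a + J3s a b a b - H4s a b b)
  + J4n a b b t.

(* Only used for [0 <= t < hypotenuse a b]; for [0 < a <= b] one has
   [height a b <= a <= b <= hypotenuse a b]. *)
Definition Jnat a b t : R :=
  let h := height a b in
  if t < h then K1 a b t
  else if t < a then K1 a b h + K2 a b t
  else if t < b then K1 a b h + K2 a b a + K3 a b t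
  else K1 a b h + K2 a b a + K3 a b b + K4 a b t.

End triangle_constants.

(* Main.v *)
(* Conditioning on the difference v of the two points, G(t) is the integral of
   area(T n (T - v)) / area(T)^2 over the disk |v| <= t.  An intersection of two
   translates of a triangle is a homothetic triangle, so its area is
   area(T) * s(v)^2 with s piecewise affine.  By the symmetry v -> -v only the
   half-plane v.1 >= 0 matters; there s is affine on three sectors, the cones
   spanned by two sides of T.  Cutting each cone along the corresponding height
   of T (for a right angled triangle two of the heights are sides, which leaves
   four pieces) turns the integral into four integrals
   int_0^p (1 - r/p)^2 min(k r, sqrt(t^2 - r^2)) dr,
   where p is a height of T and k the slope of an adjacent side.  These have
   elementary primitives and change form exactly at t = p and at
   t = p sqrt(1 + k^2), which gives the breakpoints h, a, b, c. *)

Require Import Defs.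
From HB Require Import structures.
From mathcomp Require Import all_boot all_order all_algebra.
From mathcomp Require Import all_classical all_reals all_analysis.
From mathcomp Require Import ring lra measurable_realfun.

Import Order.TTheory GRing.Theory Num.Theory.
Import numFieldNormedType.Exports.

Set Implicit Arguments.
Unset Strict Implicit.
Unset Printing Implicit Defensive.

Local Open Scope classical_set_scope.
Local Open Scope ring_scope.

(** * The law of the difference of the two points *)

Section affine_change_of_variable.
Context {R : realType}.
Notation mu := (@lebesgue_measure R).

(** [k] times the pushforward of Lebesgue measure under the affine map agrees with Lebesgue measure
    on half-open intervals, and these determine it. *)
Lemma lebesgue_measure_affine (k m : R) (A : set R) : 0 < k -> measurable A ->
  mu ((fun x => k * x + m) @^-1` A) = ((k^-1)%:E * mu A)%E.
Proof.
move=> k0 mA.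
pose f (x : measurableTypeR R) : measurableTypeR R := k * x + m.
have mf : measurable_fun setT f.
  by apply: measurable_funD => //; exact: measurable_funM.
have k1 : (0 <= k)%R by exact: ltW.
pose nu := mscale (NngNum k1) (pushforward mu f).
suff H : mu A = nu mf A.
  rewrite H /nu /mscale /= muleA -EFinM mulVf ?gt_eqF// mul1e //.
apply: (lebesgue_measure_unique (mu := nu mf)) => //= _ [[x y]] _ <-.
rewrite /nu /mscale /=.
rewrite -[pushforward mu f _]/(mu (f @^-1` `]x, y]%classic)).
have -> : f @^-1` `]x, y]%classic = `](x - m) / k, (y - m) / k]%classic.
  apply/seteqP; split => z /=; rewrite !in_itv /= /f;
  by rewrite ltr_pdivrMr// ler_pdivlMr// [z * k]mulrC ltrBlDr lerBrDr.
rewrite !lebesgue_measure_itv/= !lte_fin ltr_pM2r ?invr_gt0// ltrD2r.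
case: ifPn => _; rewrite ?mule0//.
rewrite -!EFinD -EFinM; congr (_%:E); field.
by rewrite gt_eqF.
Qed.

Lemma ge0_integral_affine (k m : R) (f : R -> \bar R) : 0 < k ->
  measurable_fun setT f -> (forall x, 0 <= f x)%E ->
  (\int[mu]_x f (k * x + m)%R = (k^-1)%:E * \int[mu]_x f x)%E.
Proof.
move=> k0 mf f0.
pose g (x : measurableTypeR R) : measurableTypeR R := k * x + m.
have mg : measurable_fun setT g.
  by apply: measurable_funD => //; exact: measurable_funM.
have := @ge0_integral_pushforward _ _ _ _ _ _ mg mu setT f measurableT mf.
move=> /(_ (fun y _ => f0 y)); rewrite preimage_setT => <-.
have k1 : (0 <= k^-1)%R by rewrite invr_ge0 ltW.
rewrite -[RHS](ge0_integral_mscale mu measurableT (NngNum k1))//.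
apply: eq_measure_integral => A mA _.
exact: lebesgue_measure_affine.
Qed.

Lemma ge0_integral_opp (f : R -> \bar R) :
  measurable_fun setT f -> (forall x, 0 <= f x)%E ->
  (\int[mu]_x f (- x)%R = \int[mu]_x f x)%E.
Proof.
move=> mf f0.
pose g (x : measurableTypeR R) : measurableTypeR R := - x.
have mg : measurable_fun setT g by exact: (measurable_funN (@measurable_id _ _ _)).
have := @ge0_integral_pushforward _ _ _ _ _ _ mg mu setT f measurableT mf.
move=> /(_ (fun y _ => f0 y)); rewrite preimage_setT => <-.
apply: eq_measure_integral => A mA _; exact: lebesgue_measureN.
Qed.

End affine_change_of_variable.

Section area_measure_instances.
Context {R : realType}.
Notation mu := (@lebesgue_measure R).

(* Canonical inference of sigma-finiteness for [mu \x mu] picks the instance for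
   subprobabilities and fails, hence this one for [area_measure]. *)
HB.instance Definition _ := Measure.copy (@area_measure R) (mu \x mu)%E.

Let area_measure_sigma_finite : sigma_finite setT (@area_measure R).
Proof.
have /sigma_finiteP[F [TF ndF Foo]] := sigma_finiteT mu.
exists (fun n => F n `*` F n).
  rewrite -setXTT TF predeqE => -[x y]; split.
    move=> [/= [n _ Fnx] [k _ Gky]]; exists (maxn n k) => //; split.
    - by move: x Fnx; exact/subsetPset/ndF/leq_maxl.
    - by move: y Gky; exact/subsetPset/ndF/leq_maxr.
  by move=> [n _ []/= ? ?]; split; exists n.
move=> k; have [? ?] := Foo k.
split; first exact: measurableX.
by rewrite /area_measure product_measure1E// lte_mul_pinfty// ge0_fin_numE.
Qed.

HB.instance Definition _ :=
  Measure_isSigmaFinite.Build _ _ _ (@area_measure R) area_measure_sigma_finite.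

End area_measure_instances.

(** * Joint law of two independent uniform points *)

Section joint_law.
Context {R : realType}.
Notation lambda2 := (@area_measure R).

(** A product measure is determined by its values on rectangles. Independence makes the law of the
    pair the product of the marginals; uniformity makes that product a multiple of the restriction
    of [lambda2 \x lambda2]. *)
Lemma uniform_pair_law (d : measure_display) (Omega : measurableType d)
    (P : probability Omega R) (X Y : {RV P >-> plane R}) (T : set (plane R))
    (A : R) (E : set (plane R * plane R)) :
  0 < A -> measurable T -> area_measure T = A%:E ->
  uniformly_distributed X T -> uniformly_distributed Y T ->
  independent_points X Y -> measurable E ->
  P [set w | E (X w, Y w)] =
  ((A ^- 2)%:E * (lambda2 \x lambda2) (E `&` (T `*` T)))%E.
Proof.
move=> A0 mT AT hX hY hXY mE.
have mTT : measurable (T `*` T) by exact: measurableX.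
have lawE (Z : {RV P >-> plane R}) B : uniformly_distributed Z T ->
    measurable B -> distribution P Z B = ((A^-1)%:E * lambda2 (B `&` T))%E.
  move=> hZ mB; rewrite hZ// AT /= [RHS]muleC EFinM; congr (_ * _)%E.
  (* [fine] loses nothing: the intersection has area at most [A]. *)
  rewrite fineK// ge0_fin_numE//; apply: (@le_lt_trans _ _ A%:E); last exact: ltry.
  by rewrite -AT; apply: le_measure; rewrite ?inE//; exact: measurableI.
pose XY w := (X w, Y w).
have mXY : measurable_fun setT XY.
  by apply: measurable_fun_pair; exact: measurable_funP.
have A2 : 0 <= A ^- 2 by rewrite invr_ge0 exprn_ge0// ltW.
transitivity ((distribution P X \x distribution P Y)%E E).
  apply/esym.
  pose nu : {measure set (plane R * plane R) -> \bar R} := pushforward P XY.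
  by rewrite (product_measure_unique (m' := nu mXY)).
pose nu := mscale (NngNum A2) (mrestr (lambda2 \x lambda2)%E mTT).
rewrite (product_measure_unique (m' := nu))// => B C mB mC.
rewrite /nu /mscale /mrestr -[LHS]/((A^-2)%:E * (lambda2 \x lambda2) ((B `*` C) `&` (T `*` T)))%E.
rewrite -setXI product_measure1E; [|exact: measurableI..].
rewrite -[RHS]/(distribution P X B * distribution P Y C)%E lawE// lawE//.
rewrite muleACA -EFinM; congr (_%:E * _)%E.
by rewrite -invfM expr2.
Qed.

End joint_law.

(** * Translation invariance and passage to the difference *)

Section shift.
Context {R : realType}.
Notation mu := (@lebesgue_measure R).
Notation lambda2 := (@area_measure R).

Lemma area_measure_shift (v : plane R) (B : set (plane R)) : measurable B ->
  lambda2 [set p | B (v.1 + p.1, v.2 + p.2)] = lambda2 B.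
Proof.
move=> mB.
pose f (p : plane R) : plane R := (v.1 + p.1, v.2 + p.2).
have mf : measurable_fun setT f.
  by apply: measurable_fun_pair; apply: measurable_funD.
pose nu : {measure set (plane R) -> \bar R} := pushforward lambda2 f.
apply/esym; apply: (product_measure_unique (m' := nu mf)) => // X Y mX mY.
rewrite -[LHS]/((mu \x mu)%E (f @^-1` (X `*` Y))).
(* The factor [1] puts both coordinate maps in the form of [lebesgue_measure_affine]. *)
have -> : f @^-1` (X `*` Y) =
    ((fun x => 1 * x + v.1) @^-1` X) `*` ((fun x => 1 * x + v.2) @^-1` Y).
  by apply/seteqP; split => -[x y] /=; rewrite /f /= !mul1r !(addrC _ x) !(addrC _ y).
have maff (c : R) Z : measurable Z ->
    measurable ((fun x : measurableTypeR R => 1 * x + c : measurableTypeR R) @^-1` Z).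
  move=> mZ; rewrite -[X in measurable X]setTI.
  suff H : measurable_fun setT
    (fun x : measurableTypeR R => 1 * x + c : measurableTypeR R) by exact: H.
  by apply: measurable_funD => //; exact: measurable_funM.
rewrite product_measure1E; [|exact: maff..].
have mu_aff (c : R) Z : measurable Z -> mu ((fun x => 1 * x + c) @^-1` Z) = mu Z.
  by move=> mZ; rewrite lebesgue_measure_affine// invr1 mul1e.
by congr (_ * _)%E; exact: mu_aff.
Qed.

(** The shear sending (p, v) to (p, p + v) preserves the measure, since for fixed p it is a
    translation in v. *)
Lemma area_measure2_shift (E : set (plane R * plane R)) : measurable E ->
  ((lambda2 \x lambda2) E =
   \int[lambda2]_v lambda2 [set p | E (p, (p.1 + v.1, p.2 + v.2)%R)])%E.
Proof.
move=> mE.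
pose F (z : plane R * plane R) : plane R * plane R :=
  (z.1, (z.1.1 + z.2.1, z.1.2 + z.2.2)).
have mF : measurable_fun setT F.
  apply: measurable_fun_pair => //; apply: measurable_fun_pair;
    apply: measurable_funD => //; exact: measurableT_comp.
have mFE : measurable (F @^-1` E).
  by rewrite -[X in measurable X]setTI; exact: mF.
transitivity ((lambda2 \x lambda2)%E (F @^-1` E)).
  apply: eq_integral => p _ /=.
  rewrite -(@area_measure_shift p); last exact: measurable_xsection.
  by congr lambda2; apply/seteqP; split => v; rewrite /xsection /= !inE.
(* By uniqueness of the product measure, the order of integration can be exchanged so that [v]
   becomes the outer variable. *)
transitivity ((lambda2 \x^ lambda2)%E (F @^-1` E)).
  apply: product_measure_unique mFE => A B mA mB.
  exact: product_measure2E.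
apply: eq_integral => v _.
rewrite -[LHS]/(lambda2 (ysection (F @^-1` E) v)).
by congr lambda2; apply/seteqP; split => p; rewrite /ysection /= !inE.
Qed.

End shift.

(** * Fundamental theorem of calculus *)

Section ftc.
Context {R : realType}.
Notation mu := (@lebesgue_measure R).

(** The derivative is asked for only inside the interval because the arcsine in the primitive used
    later is not differentiable at the end [r = t]. *)
Lemma integral_FTC (f F : R -> R) (x y : R) : x <= y ->
  {within `[x, y], continuous f} -> {within `[x, y], continuous F} ->
  {in `]x, y[, forall z : R, is_derive z 1 F (f z)} ->
  (\int[mu]_(z in `[x, y]) (f z)%:E = (F y - F x)%:E)%E.
Proof.
rewrite le_eqVlt => /predU1P[<- _ _ _|xy cf cF dF].
  by rewrite set_itv1 integral_set1 subrr.
have [cFo cFr cFl] := (continuous_within_itvP _ xy).1 cF.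
rewrite (@continuous_FTC2 _ _ F _ _ xy cf) ?EFinB//.
- by split => // z zxy; have [] := dF z zxy.
- by move=> z zxy; rewrite derive1E; have [_ ->] := dF z zxy.
Qed.

Lemma integral_FTC_cont (f F : R -> R) (x y : R) : x <= y -> continuous f ->
  (forall z : R, is_derive z 1 F (f z)) ->
  (\int[mu]_(z in `[x, y]) (f z)%:E = (F y - F x)%:E)%E.
Proof.
move=> xy cf dF; apply: integral_FTC => //; first exact: continuous_subspaceT.
apply: continuous_subspaceT => z.
by apply: differentiable_continuous; apply/derivable1_diffP; have [] := dF z.
Qed.

End ftc.

(** * Area of a right triangle with legs parallel to the axes *)

Section corner_triangle.
Context {R : realType}.
Notation mu := (@lebesgue_measure R).

(** The vertical chord at [x] has length [b / a * (x1 - x)] on [[x0, x1]]; the maximum with 0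
    accounts for an empty triangle. *)
Lemma area_corner_triangle (a b x0 y0 r : R) : 0 < a -> 0 < b ->
  area_measure [set p : plane R | [/\ x0 <= p.1, y0 <= p.2 & p.1 / a + p.2 / b <= r]]
  = (a * b / 2 * Num.max 0 (r - x0 / a - y0 / b) ^+ 2)%:E.
Proof.
move=> a0 b0; set S := [set p | _].
(* The oblique side meets the line [y = y0] at this abscissa. *)
pose x1 := a * (r - y0 / b).
pose D := `[x0, x1].
have sec x : mu (xsection S x) =
    ((fun z => (b / a * (x1 - z))%:E) \_ [set` D]) x.
  rewrite patchE mem_setE; case: ifPn.
    rewrite in_itv /= => /andP[x0x xx1].
    have -> : xsection S x = `[y0, b * (r - x / a)]%classic.
      apply/seteqP; split => y; rewrite /xsection /= inE /S /= in_itv /=.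
        move=> [_ -> H] /=; rewrite -ler_pdivrMl// mulrC; lra.
      move=> /andP[-> H]; split => //.
      move: H; rewrite -ler_pdivrMl// [_^-1 * y]mulrC; lra.
    rewrite lebesgue_measure_itv /= lte_fin; case: ltP => H.
      rewrite -EFinD; congr _%:E; rewrite /x1; field.
      by rewrite !gt_eqF.
    (* Here the chord has length zero, and [x <= x1] forces the claimed length to vanish too. *)
    congr _%:E.
    have : b / a * (x1 - x) <= 0.
      rewrite (_ : _ * _ = b * (r - x / a) - y0) ?subr_le0// /x1; field.
      by rewrite !gt_eqF.
    have : 0 <= b / a * (x1 - x) by rewrite mulr_ge0 ?divr_ge0 ?subr_ge0// ltW.
    by lra.
  rewrite in_itv /= => H.
  have -> : xsection S x = set0; last by rewrite measure0.
  apply/seteqP; split => // y; rewrite /xsection /= inE /S /=.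
  move=> [x0x y0y rr]; move: H; rewrite x0x /= -ltNge /x1 => H.
  have : y0 / b <= y / b by rewrite ler_pM2r ?invr_gt0.
  move: H; rewrite -ltr_pdivlMl// mulrC; lra.
rewrite /area_measure /product_measure1 /=.
under eq_integral do rewrite sec.
rewrite -integral_mkcond.
have x1E : x1 - x0 = a * (r - x0 / a - y0 / b).
  by rewrite /x1; field; rewrite !gt_eqF.
have [x01|x10] := leP x0 x1; last first.
  rewrite set_itv_ge ?bnd_simp -?ltNge// integral_set0.
  rewrite max_l ?expr0n ?mulr0//.
  by rewrite -(pmulr_rle0 _ a0) -x1E subr_le0 ltW.
rewrite max_r; last by rewrite -(pmulr_rge0 _ a0) -x1E subr_ge0.
pose F z := - (b / (2 * a) * (x1 - z) ^+ 2).
have dF (z : R) : is_derive z 1 F (b / a * (x1 - z)).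
  apply: is_derive_eq; rewrite /GRing.scale /= ?mulr1 ?expr1; field.
  by rewrite !gt_eqF.
rewrite (integral_FTC_cont x01 _ dF).
  congr _%:E; rewrite /F subrr expr0n mulr0 oppr0 sub0r opprK x1E; field.
  by rewrite !gt_eqF.
by move=> z; apply: cvgM; [exact: cvg_cst|apply: cvgB; [exact: cvg_cst|exact: cvg_id]].
Qed.

End corner_triangle.

(** * Overlap of the triangle with its translates *)

Section covariogram.
Context {R : realType}.
Notation mu := (@lebesgue_measure R).
Notation lambda2 := (@area_measure R).

Lemma measurable_bool_set d (T : measurableType d) (f : T -> bool) :
  measurable_fun setT f -> measurable [set x | f x].
Proof. by move=> mf; rewrite -[X in measurable X]setTI; exact: mf. Qed.

Lemma right_triangleE (a b : R) : 0 < a -> 0 < b -> right_triangle a b =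
  [set p | [/\ 0 <= p.1, 0 <= p.2 & p.1 / a + p.2 / b <= 1]].
Proof.
move=> a0 b0; apply/seteqP; split=> [_ [l [m [n [l0 m0 n0 lmn ->]]]]|[x y]] /=.
  rewrite !mulr0 !addr0 add0r !mulfK ?gt_eqF//.
  by split; rewrite ?mulr_ge0 ?(ltW a0) ?(ltW b0)//; lra.
move=> [x0 y0 xy]; exists (y / b), (x / a), (1 - x / a - y / b); split.
- by rewrite divr_ge0// ltW.
- by rewrite divr_ge0// ltW.
- by lra.
- by lra.
- by rewrite !mulr0 !addr0 add0r !divfK ?gt_eqF.
Qed.

Lemma measurable_right_triangle (a b : R) : 0 < a -> 0 < b ->
  measurable (right_triangle a b).
Proof.
move=> a0 b0; rewrite right_triangleE//.
rewrite [X in measurable X](_ : _ = [set p : plane R |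
    [&& 0 <= p.1, 0 <= p.2 & p.1 / a + p.2 / b <= 1]]); last first.
  by apply/seteqP; split => p /= /and3P.
apply: measurable_bool_set; repeat apply: measurable_and;
  apply: measurable_fun_ler => //.
by apply: measurable_funD; apply: measurable_funM.
Qed.

(** Ratio of the homothety taking [T] to its intersection with [T - (x, y)], truncated at 0 when
    they do not meet. The inner maxima locate the right-angled corner, the minimum the oblique
    side. *)
Definition overlap_ratio (a b x y : R) : R :=
  Num.max 0 (Num.min 1 (1 - (x / a + y / b))
             - Num.max 0 (- x) / a - Num.max 0 (- y) / b).

(** The inequalities of the two triangles combine side by side into those of one corner triangle. *)
Lemma area_overlap (a b x y : R) : 0 < a -> 0 < b ->
  lambda2 [set p | right_triangle a b p /\ right_triangle a b (p.1 + x, p.2 + y)]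
  = (a * b / 2 * overlap_ratio a b x y ^+ 2)%:E.
Proof.
move=> a0 b0; rewrite right_triangleE// /overlap_ratio -area_corner_triangle//.
congr lambda2; apply/seteqP; split => -[p q] /=.
  move=> [[p0 q0 pq] [px qy pqxy]]; rewrite le_min !ge_max; split.
  - by apply/andP; split => //; lra.
  - by apply/andP; split => //; lra.
  - by apply/andP; split => //; lra.
rewrite le_min !ge_max => -[/andP[p0 px] /andP[q0 qy] /andP[pq pqxy]].
by split; split => //; lra.
Qed.

Lemma area_right_triangle (a b : R) : 0 < a -> 0 < b ->
  area_measure (right_triangle a b) = (area a b)%:E.
Proof.
move=> a0 b0.
rewrite right_triangleE// area_corner_triangle// !mul0r !subr0.
by rewrite max_r// expr1n mulr1.
Qed.

Lemma measurable_overlap_ratio (a b : R) : measurable_fun setT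
  (fun v : plane R => overlap_ratio a b v.1 v.2).
Proof.
apply: measurable_maxr => //.
apply: measurable_funB; [apply: measurable_funB|].
- apply: measurable_minr => //; apply: measurable_funB => //.
  by apply: measurable_funD; exact: measurable_funM.
- apply: measurable_funM => //; apply: measurable_maxr => //.
  exact: measurable_funN.
- apply: measurable_funM => //; apply: measurable_maxr => //.
  exact: measurable_funN.
Qed.

(** Overlap area relative to that of the triangle, cut off to the disc of radius [t]. *)
Definition ball_overlap (a b t x y : R) : R :=
  if x ^+ 2 + y ^+ 2 <= t ^+ 2 then overlap_ratio a b x y ^+ 2 else 0.

Lemma measurable_ball_overlap (a b t : R) : measurable_fun setT
  (fun v : plane R => ball_overlap a b t v.1 v.2).
Proof.
apply: measurable_fun_ifT => //.
- apply: measurable_fun_ler => //.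
  by apply: measurable_funD; apply: measurable_funX.
- by apply: measurable_funX; exact: measurable_overlap_ratio.
Qed.

Definition close_pairs (t : R) : set (plane R * plane R) :=
  [set z | (z.1.1 - z.2.1) ^+ 2 + (z.1.2 - z.2.2) ^+ 2 <= t ^+ 2].

Lemma measurable_close_pairs (t : R) : measurable (close_pairs t).
Proof.
apply: measurable_bool_set; apply: measurable_fun_ler => //.
apply: measurable_funD; apply: measurable_funX; apply: measurable_funB;
  exact: measurableT_comp.
Qed.

Lemma distance_distribution_pairs (d : measure_display) (Omega : measurableType d)
    (P : probability Omega R) (X Y : {RV P >-> plane R}) (a b t : R) :
  0 < a -> 0 < b -> 0 <= t ->
  uniformly_distributed X (right_triangle a b) ->
  uniformly_distributed Y (right_triangle a b) ->
  independent_points X Y ->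
  distance_distribution X Y t =
  ((area a b ^- 2)%:E * (lambda2 \x lambda2)
    (close_pairs t `&` (right_triangle a b `*` right_triangle a b)))%E.
Proof.
move=> a0 b0 t0 hX hY hXY.
have A0 : 0 < area a b by rewrite divr_gt0 ?mulr_gt0.
rewrite /distance_distribution.
have -> : [set w | euclidean_dist (X w) (Y w) <= t] = [set w | close_pairs t (X w, Y w)].
  have distE (p q : plane R) : (euclidean_dist p q <= t) =
      ((p.1 - q.1) ^+ 2 + (p.2 - q.2) ^+ 2 <= t ^+ 2).
    by rewrite -[RHS]ler_sqrt ?sqr_ge0// sqrtr_sqr ger0_norm.
  by apply/seteqP; split => w /=; rewrite distE.
exact: (uniform_pair_law A0 (measurable_right_triangle a0 b0)
  (area_right_triangle a0 b0) hX hY hXY (measurable_close_pairs t)).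
Qed.

(** Coordinates of points of the triangle differ by at most [a] and [b], so every pair of points is
    close and the whole square of the triangle is measured. *)
Lemma distance_distribution_ge_hypotenuse (d : measure_display)
    (Omega : measurableType d) (P : probability Omega R)
    (X Y : {RV P >-> plane R}) (a b t : R) :
  0 < a -> 0 < b -> hypotenuse a b <= t ->
  uniformly_distributed X (right_triangle a b) ->
  uniformly_distributed Y (right_triangle a b) ->
  independent_points X Y ->
  distance_distribution X Y t = 1%E.
Proof.
move=> a0 b0 ct hX hY hXY.
have t0 : 0 <= t by rewrite (le_trans _ ct)// sqrtr_ge0.
have A0 : 0 < area a b by rewrite divr_gt0 ?mulr_gt0.
have mT := measurable_right_triangle a0 b0.
have ct2 : a ^+ 2 + b ^+ 2 <= t ^+ 2.
  by rewrite -[leLHS]sqr_sqrtr ?addr_ge0 ?sqr_ge0// ler_pXn2r ?nnegrE ?sqrtr_ge0.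
rewrite (distance_distribution_pairs a0 b0 t0 hX hY hXY) setIidr; last first.
  move=> [[x y] [x' y']] []; rewrite right_triangleE// /= => -[x0 y0 xy] [x'0 y'0 xy'].
  have coord_le (u v : R) : 0 < u -> 0 <= v -> v / u <= 1 -> v <= u.
    by move=> u0 v0; rewrite ler_pdivrMr// mul1r.
  have [xa xb] : 0 <= x / a /\ 0 <= y / b by rewrite !divr_ge0 ?(ltW a0) ?(ltW b0).
  have [xa' xb'] : 0 <= x' / a /\ 0 <= y' / b by rewrite !divr_ge0 ?(ltW a0) ?(ltW b0).
  have sqr_le (u v w : R) : 0 <= u -> u <= w -> 0 <= v -> v <= w -> (u - v) ^+ 2 <= w ^+ 2.
    move=> u0 uw v0 vw; rewrite -[leLHS]real_normK ?num_real//.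
    rewrite ler_pXn2r ?nnegrE ?(le_trans u0 uw)//.
    by rewrite ler_norml; apply/andP; split; lra.
  rewrite /close_pairs /=; apply: le_trans ct2; apply: lerD.
    by apply: sqr_le => //; apply: coord_le => //; lra.
  by apply: sqr_le => //; apply: coord_le => //; lra.
rewrite product_measure1E//.
transitivity ((area a b ^- 2)%:E * ((area a b)%:E * (area a b)%:E))%E.
  by congr (_ * (_ * _))%E; exact: area_right_triangle.
rewrite -!EFinM; congr _%:E; field.
by rewrite gt_eqF.
Qed.

(** After the shear, the slice over [v] is an overlap of two translates if [v] lies in the disc and
    is empty otherwise. Tonelli then splits the integral over [v]. *)
Lemma distance_distributionE (d : measure_display) (Omega : measurableType d)
    (P : probability Omega R) (X Y : {RV P >-> plane R}) (a b t : R) :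
  0 < a -> 0 < b -> 0 <= t ->
  uniformly_distributed X (right_triangle a b) ->
  uniformly_distributed Y (right_triangle a b) ->
  independent_points X Y ->
  distance_distribution X Y t =
  (((area a b)^-1)%:E * \int[mu]_x \int[mu]_y (ball_overlap a b t x y)%:E)%E.
Proof.
move=> a0 b0 t0 hX hY hXY.
have A0 : 0 < area a b by rewrite divr_gt0 ?mulr_gt0.
have mT := measurable_right_triangle a0 b0.
rewrite (distance_distribution_pairs a0 b0 t0 hX hY hXY).
rewrite area_measure2_shift; last first.
  by apply: measurableI; [exact: measurable_close_pairs|exact: measurableX].
have shiftE (p z : R) : (p - (p + z)) ^+ 2 = z ^+ 2 by ring.
have mg := measurable_ball_overlap a b t.
have mge : measurable_fun setT (fun v : plane R => (ball_overlap a b t v.1 v.2)%:E).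
  exact/measurable_EFinP.
have g0 (v : plane R) : (0 <= (ball_overlap a b t v.1 v.2)%:E)%E.
  by rewrite lee_fin /ball_overlap; case: ifP => // _; rewrite sqr_ge0.
transitivity ((area a b ^- 2)%:E * ((area a b)%:E *
    \int[lambda2]_v (ball_overlap a b t v.1 v.2)%:E))%E.
  congr (_ * _)%E; rewrite -ge0_integralZl ?lee_fin ?(ltW A0)//.
  apply: eq_integral => -[x y] _ /=; rewrite /ball_overlap -EFinM.
  case: ifPn => xyt; last first.
    rewrite mulr0 [X in lambda2 X](_ : _ = set0) ?measure0//.
    apply/seteqP; split => // -[p q] [/=]; rewrite /close_pairs /= !shiftE.
    by move: xyt => /negP.
  rewrite -area_overlap//; congr lambda2; apply/seteqP; split => -[p q] /=.
    by move=> [_ [? ?]].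
  move=> [? ?]; split => //; by rewrite /close_pairs /= !shiftE.
rewrite muleA -EFinM; congr (_ * _)%E.
  by congr _%:E; field; rewrite gt_eqF.
exact: (fubini_tonelli1 (m1 := mu) (m2 := mu) _ mge g0).
Qed.

End covariogram.

(** * Decomposition into sectors *)

Section sectors.
Context {R : realType}.
Notation mu := (@lebesgue_measure R).
Implicit Types (a b t x y z p k : R).

Lemma normr_le_sqrt y D : y ^+ 2 <= D -> `|y| <= Num.sqrt D.
Proof. by rewrite -sqrtr_sqr; exact: ler_wsqrtr. Qed.

(** No sign of [D] is assumed: [Num.sqrt] is 0 on negative numbers, which the strict inequality
    excludes. With the preceding lemma it encloses the chords of the disc between an open and a
    closed interval. *)
Lemma normr_lt_sqrt y D : `|y| < Num.sqrt D -> y ^+ 2 <= D.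
Proof.
by rewrite ltNge -sqrtr_sqr; case: (leP (y ^+ 2)) => // /ltW H; rewrite ler_wsqrtr.
Qed.

(** Spares deciding which endpoints belong to [S]. *)
Lemma lebesgue_measure_sandwich (S : set R) (l r : R) : measurable S ->
  l <= r -> `]l, r[ `<=` S -> S `<=` `[l, r] -> mu S = (r - l)%:E.
Proof.
move=> mS; rewrite le_eqVlt => /predU1P[<- _ Sl|lr lrS Slr].
  apply/eqP; rewrite subrr eq_le measure_ge0 andbT.
  have := le_measure mu (mem_set mS) (mem_set (measurable_itv `[l, l])) Sl.
  by rewrite /= lebesgue_measure_itv /= ltxx.
apply/eqP; rewrite eq_le.
have := le_measure mu (mem_set mS) (mem_set (measurable_itv `[l, r])) Slr.
have := le_measure mu (mem_set (measurable_itv `]l, r[)) (mem_set mS) lrS.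
rewrite /= !lebesgue_measure_itv /= lte_fin lr -EFinD => H1 H2.
by apply/andP.
Qed.

Lemma integral_if_cst (c : R -> bool) (w : R) : 0 <= w ->
  measurable_fun setT (c : measurableTypeR R -> bool) ->
  (\int[mu]_y (if c y then w else 0)%:E = w%:E * mu [set y | c y])%E.
Proof.
move=> w0 mc; rewrite -integral_cst; last exact: measurable_bool_set.
rewrite [RHS]integral_mkcond; apply: eq_integral => y _ /=.
by rewrite patchE; case cy: (c y); [rewrite mem_set|rewrite memNset//= cy].
Qed.

(* The contribution of a right triangle with legs [p] and [k * p], where [p] is
   measured from the apex of the cone. *)
Definition sector_integral (p k t : R) : \bar R :=
  (\int[mu]_(r in `[0%R, p])
     ((1 - r / p) ^+ 2 * Num.min (k * r) (Num.sqrt (t ^+ 2 - r ^+ 2)))%:E)%E.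

Lemma integral_pos_part (p : R) (m : R -> R) : 0 < p ->
  (\int[mu]_r (if 0 <= r then Num.max 0 (1 - r / p) ^+ 2 * m r else 0)%:E =
   \int[mu]_(r in `[0%R, p]) ((1 - r / p) ^+ 2 * m r)%:E)%E.
Proof.
move=> p0; rewrite [RHS]integral_mkcond; apply: eq_integral => r _.
rewrite patchE mem_setE in_itv /=.
case: (leP 0 r) => //= r0; case: (leP r p) => rp.
  by rewrite max_r// subr_ge0 ler_pdivrMr// mul1r.
by rewrite max_l ?expr0n ?mul0r// subr_le0 ler_pdivlMr// mul1r ltW.
Qed.

(* On [0 <= x], [ball_overlap] is the sum of the restrictions below to the cones
   spanned by the three pairs of sides of the triangle. *)
Definition sector1 a b t x y : R :=
  if [&& 0 <= x, 0 <= y & x ^+ 2 + y ^+ 2 <= t ^+ 2]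
  then Num.max 0 (1 - (x / a + y / b)) ^+ 2 else 0.

Definition sector2 a b t x y : R :=
  if [&& 0 <= x, y < 0, - (b / a * x) <= y & x ^+ 2 + y ^+ 2 <= t ^+ 2]
  then Num.max 0 (1 - x / a) ^+ 2 else 0.

Definition sector3 a b t x y : R :=
  if [&& 0 <= x, y < - (b / a * x) & x ^+ 2 + y ^+ 2 <= t ^+ 2]
  then Num.max 0 (1 + y / b) ^+ 2 else 0.

(** Geometrically, the intersections of [T] with [T + v] and with [T - v] are translates of each
    other. In formulas this is [max 0 z = max 0 (- z) + z]. *)
Lemma ball_overlapN a b t x y : ball_overlap a b t (- x) (- y) = ball_overlap a b t x y.
Proof.
rewrite /ball_overlap !sqrrN; case: ifP => // _.
suff -> : overlap_ratio a b (- x) (- y) = overlap_ratio a b x y by [].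
rewrite /overlap_ratio !opprK; congr Num.max.
have maxN z : Num.max 0 z = Num.max 0 (- z) + z by case: (ltP 0 z); case: (ltP 0 (-z)); lra.
rewrite (maxN x) (maxN y) !mulNr.
by case: (leP 1 (1 - (x / a + y / b))); case: (leP 1 (1 - (- (x / a) - y / b))); lra.
Qed.

(** The sign of [y] and the comparison of [y / b] with [- (x / a)] decide which terms of the maxima
    and the minimum are active. Strict inequalities give each boundary ray to a single cone. *)
Lemma ball_overlapE a b t x y : 0 < a -> 0 < b -> 0 <= x ->
  ball_overlap a b t x y = sector1 a b t x y + sector2 a b t x y + sector3 a b t x y.
Proof.
move=> a0 b0 x0; rewrite /ball_overlap /sector1 /sector2 /sector3 x0 /=.
case: ifP => _; rewrite ?andbF ?addr0// !andbT /overlap_ratio.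
have xa : 0 <= x / a by rewrite divr_ge0// ltW.
have bax : b / a * x = b * (x / a) by ring.
rewrite (_ : Num.max 0 (- x) = 0); last by rewrite max_l// oppr_le0.
rewrite mul0r subr0; case: (leP 0 y) => y0 /=.
  have yb : 0 <= y / b by rewrite divr_ge0// ltW.
  have bax0 : 0 <= b / a * x by rewrite bax mulr_ge0// ltW.
  rewrite (_ : _ < _ = false); last by apply/negbTE; rewrite -leNgt; lra.
  rewrite !addr0 (_ : Num.max 0 (- y) = 0); last by rewrite max_l// oppr_le0.
  by rewrite mul0r subr0 min_r//; lra.
rewrite add0r (_ : Num.max 0 (- y) = - y); last by rewrite max_r// oppr_ge0 ltW.
have yb : (- (b / a * x) <= y) = (- (x / a) <= y / b).
  by rewrite bax -mulrN mulrC -ler_pdivlMr.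
rewrite ltNge yb; case: leP => H /=; rewrite ?addr0 ?add0r.
  rewrite min_r; last by lra.
  by congr (Num.max _ _ ^+ 2); rewrite mulNr; lra.
rewrite min_l; last by lra.
by congr (Num.max _ _ ^+ 2); rewrite mulNr; lra.
Qed.

Lemma measurable_sector1 a b t :
  measurable_fun setT (fun v : plane R => sector1 a b t v.1 v.2).
Proof.
apply: measurable_fun_ifT => //.
- repeat apply: measurable_and; apply: measurable_fun_ler => //.
  by apply: measurable_funD; apply: measurable_funX.
- apply: measurable_funX; apply: measurable_maxr => //; apply: measurable_funB => //.
  by apply: measurable_funD; apply: measurable_funM.
Qed.

Lemma measurable_sector2 a b t :
  measurable_fun setT (fun v : plane R => sector2 a b t v.1 v.2).
Proof.
apply: measurable_fun_ifT => //.
- repeat apply: measurable_and;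
    [exact: measurable_fun_ler|exact: measurable_fun_ltr|apply: measurable_fun_ler => //..].
  + by apply: measurable_funN; exact: measurable_funM.
  + by apply: measurable_funD; apply: measurable_funX.
- apply: measurable_funX; apply: measurable_maxr => //; apply: measurable_funB => //.
  by apply: measurable_funM.
Qed.

Lemma measurable_sector3 a b t :
  measurable_fun setT (fun v : plane R => sector3 a b t v.1 v.2).
Proof.
apply: measurable_fun_ifT => //.
- repeat apply: measurable_and;
    [exact: measurable_fun_ler|apply: measurable_fun_ltr => //|apply: measurable_fun_ler => //].
  + by apply: measurable_funN; exact: measurable_funM.
  + by apply: measurable_funD; apply: measurable_funX.
- apply: measurable_funX; apply: measurable_maxr => //; apply: measurable_funD => //.
  by apply: measurable_funM.
Qed.

Lemma sector1_ge0 a b t x y : 0 <= sector1 a b t x y.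
Proof. by rewrite /sector1; case: ifP => // _; rewrite sqr_ge0. Qed.

Lemma sector2_ge0 a b t x y : 0 <= sector2 a b t x y.
Proof. by rewrite /sector2; case: ifP => // _; rewrite sqr_ge0. Qed.

Lemma sector3_ge0 a b t x y : 0 <= sector3 a b t x y.
Proof. by rewrite /sector3; case: ifP => // _; rewrite sqr_ge0. Qed.

(** The weight depends on [x] only, so the inner integral is the weight times the length of a
    vertical chord of the cone cut by the disc. *)
Lemma integral_sector2 a b t : 0 < a -> 0 < b ->
  (\int[mu]_x \int[mu]_y (sector2 a b t x y)%:E = sector_integral a (b / a) t)%E.
Proof.
move=> a0 b0; rewrite /sector_integral.
rewrite -(integral_pos_part (fun r => Num.min (b / a * r) (Num.sqrt (t ^+ 2 - r ^+ 2))))//.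
apply: eq_integral => x _; rewrite /sector2.
case: (leP 0 x) => x0 /=; last by rewrite integral0.
rewrite integral_if_cst ?sqr_ge0//; last first.
  repeat apply: measurable_and;
    [exact: measurable_fun_ltr|apply: measurable_fun_ler => //..].
  by apply: measurable_funD => //; exact: measurable_funX.
set q := Num.sqrt _; set k := b / a * x.
have k0 : 0 <= k by rewrite mulr_ge0// divr_ge0 ?ltW.
rewrite (@lebesgue_measure_sandwich _ (- Num.min k q) 0).
- by rewrite sub0r opprK EFinM.
- apply: measurable_bool_set; repeat apply: measurable_and;
    [exact: measurable_fun_ltr|apply: measurable_fun_ler => //..].
  by apply: measurable_funD => //; exact: measurable_funX.
- by rewrite oppr_le0 le_min k0 sqrtr_ge0.
- move=> y /=; rewrite in_itv /= ltrNl lt_min => /andP[/andP[H1 H2] H3].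
  rewrite H3 /= lerNl (ltW H1) /= addrC -lerBrDr; apply: normr_lt_sqrt.
  by rewrite ltr0_norm.
- move=> y /= /and3P[H1 H2 H3]; rewrite in_itv /= (ltW H1) andbT.
  rewrite lerNl le_min lerNl H2 /= -ltr0_norm//; apply: normr_le_sqrt.
  by rewrite lerBrDr addrC.
Qed.

(** Here the weight depends on [y] only: the integrations are exchanged and [y] is replaced by [- z]
    before horizontal chords are measured. *)
Lemma integral_sector3 a b t : 0 < a -> 0 < b ->
  (\int[mu]_x \int[mu]_y (sector3 a b t x y)%:E = sector_integral b (a / b) t)%E.
Proof.
move=> a0 b0; rewrite /sector_integral.
rewrite -(integral_pos_part (fun r => Num.min (a / b * r) (Num.sqrt (t ^+ 2 - r ^+ 2))))//.
have mf : measurable_fun setT (fun v : plane R => (sector3 a b t v.1 v.2)%:E).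
  by apply/measurable_EFinP; exact: measurable_sector3.
have f0 (v : plane R) : (0 <= (sector3 a b t v.1 v.2)%:E)%E.
  by rewrite lee_fin sector3_ge0.
rewrite (fubini_tonelli (m1 := mu) (m2 := mu) _ mf f0) /=.
rewrite -ge0_integral_opp; last 2 first.
- exact: (measurable_fun_fubini_tonelli_G (m1 := mu) _ mf f0).
- by move=> y; apply: integral_ge0 => x _; rewrite lee_fin sector3_ge0.
apply: eq_integral => z _; rewrite /sector3.
have E x : (- z < - (b / a * x)) = (x < a / b * z).
  rewrite ltrN2 mulrAC ltr_pdivrMr// [a / b * z]mulrAC ltr_pdivlMr//.
  by rewrite mulrC [z * a]mulrC.
under eq_integral do rewrite E mulNr sqrrN.
case: (leP 0 z) => z0 /=; last first.
  rewrite integral0_eq// => x _.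
  case: ifP => // /and3P[x0 H _]; exfalso.
  by move: H; rewrite ltNge (le_trans _ x0)// pmulr_rle0 ?divr_gt0// ltW.
rewrite integral_if_cst ?sqr_ge0//; last first.
  repeat apply: measurable_and;
    [exact: measurable_fun_ler|exact: measurable_fun_ltr|apply: measurable_fun_ler => //].
  by apply: measurable_funD => //; exact: measurable_funX.
set q := Num.sqrt _; set k := a / b * z.
have k0 : 0 <= k by rewrite mulr_ge0// divr_ge0 ?ltW.
rewrite (@lebesgue_measure_sandwich _ 0 (Num.min k q)).
- by rewrite subr0 EFinM.
- apply: measurable_bool_set; repeat apply: measurable_and;
    [exact: measurable_fun_ler|exact: measurable_fun_ltr|apply: measurable_fun_ler => //].
  by apply: measurable_funD => //; exact: measurable_funX.
- by rewrite le_min k0 sqrtr_ge0.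
- move=> y /=; rewrite in_itv /= lt_min => /andP[H3 /andP[H1 H2]].
  rewrite (ltW H3) H1 /= -lerBrDr; apply: normr_lt_sqrt.
  by rewrite gtr0_norm.
- move=> y /= /and3P[H1 H2 H3]; rewrite in_itv /= H1 le_min (ltW H2) /=.
  rewrite -[y]ger0_norm//; apply: normr_le_sqrt.
  by rewrite lerBrDr.
Qed.

End sectors.

(** * Reduction to four sector integrals *)

Section total.
Context {R : realType}.
Notation mu := (@lebesgue_measure R).
Implicit Types (a b c t x y z p k h : R).

Lemma measurable_min_sqrt p k t : measurable_fun setT
  (fun r : measurableTypeR R => (1 - r / p) ^+ 2 * Num.min (k * r) (Num.sqrt (t ^+ 2 - r ^+ 2))).
Proof.
apply: measurable_funM.
  by apply: measurable_funX; apply: measurable_funB => //; exact: measurable_funM.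
apply: measurable_minr; first exact: measurable_funM.
apply: (measurableT_comp (continuous_measurable_fun (@sqrt_continuous R))).
by apply: measurable_funB => //; exact: measurable_funX.
Qed.

Lemma measurable_sector1_comp d (T : measurableType d) a b t
    (f g : T -> measurableTypeR R) :
  measurable_fun setT f -> measurable_fun setT g ->
  measurable_fun setT (fun w => sector1 a b t (f w) (g w)).
Proof.
move=> mf mg; have mfg : measurable_fun setT (fun w => (f w, g w) : plane R).
  exact: measurable_fun_pair.
exact: (measurableT_comp (measurable_sector1 a b t) mfg).
Qed.

(* The second coordinate is replaced by the distance [r] to the apex measured
   along the height [h]; the chord at distance [r] is cut by the foot of [h] into
   two pieces, one for each of the two right triangles. *)
Lemma integral_sector1 a b c t : 0 < a -> 0 < b -> 0 < c ->
  c ^+ 2 = a ^+ 2 + b ^+ 2 -> let h := a * b / c in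
  (\int[mu]_x \int[mu]_y (sector1 a b t x y)%:E =
   sector_integral h (a / b) t + sector_integral h (b / a) t)%E.
Proof.
move=> a0 b0 c0 cab h.
have h0 : 0 < h by rewrite divr_gt0 ?mulr_gt0.
have mn0 k r : 0 <= k -> 0 <= r -> 0 <= Num.min (k * r) (Num.sqrt (t ^+ 2 - r ^+ 2)).
  by move=> k0 r0; rewrite le_min mulr_ge0// sqrtr_ge0.
rewrite /sector_integral -ge0_integralD//=; last 4 first.
- move=> r; rewrite in_itv /= => /andP[r0 _].
  by rewrite lee_fin mulr_ge0 ?sqr_ge0 ?mn0// divr_ge0 ?ltW.
- apply/measurable_EFinP; apply: measurable_funTS; exact: measurable_min_sqrt.
- move=> r; rewrite in_itv /= => /andP[r0 _].
  by rewrite lee_fin mulr_ge0 ?sqr_ge0 ?mn0// divr_ge0 ?ltW.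
- apply/measurable_EFinP; apply: measurable_funTS; exact: measurable_min_sqrt.
under [RHS]eq_integral do rewrite -EFinD -mulrDr.
rewrite -(integral_pos_part (fun r => Num.min (a / b * r) (Num.sqrt (t ^+ 2 - r ^+ 2))
  + Num.min (b / a * r) (Num.sqrt (t ^+ 2 - r ^+ 2))))//.
have ca0 : 0 < c / a by rewrite divr_gt0.
(* The distance along the height is [r = (b * x + a * y) / c]; this is solved for [y], with Jacobian
   [c / a]. *)
pose f (v : plane R) := sector1 a b t v.1 (c / a * v.2 + (- (b / a * v.1))).
have mf : measurable_fun setT (fun v : plane R => (f v)%:E).
  apply/measurable_EFinP.
  apply: measurable_sector1_comp => //; apply: measurable_funD; first exact: measurable_funM.
  by apply: measurable_funN; exact: measurable_funM.
have f0 (v : plane R) : (0 <= (f v)%:E)%E by rewrite lee_fin sector1_ge0.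
have -> : (\int[mu]_x \int[mu]_y (sector1 a b t x y)%:E =
    (c / a)%:E * \int[mu]_x \int[mu]_r (f (x, r))%:E)%E.
  rewrite -ge0_integralZl_EFin ?(ltW ca0)//; last 2 first.
  - by move=> x _; exact: integral_ge0.
  - exact: (measurable_fun_fubini_tonelli_F (m2 := mu) _ mf f0).
  apply: eq_integral => x _; rewrite /f /=.
  rewrite (ge0_integral_affine _ (f := fun y => (sector1 a b t x y)%:E))//.
  - by rewrite muleA -EFinM divff ?mul1e// gt_eqF.
  - apply/measurable_EFinP.
    exact: measurable_sector1_comp.
  - by move=> y; rewrite lee_fin sector1_ge0.
rewrite (fubini_tonelli (m1 := mu) (m2 := mu) _ mf f0) /=.
rewrite -ge0_integralZl_EFin ?(ltW ca0)//; last 2 first.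
- by move=> x _; exact: integral_ge0.
- exact: (measurable_fun_fubini_tonelli_G (m1 := mu) _ mf f0).
apply: eq_integral => r _; rewrite /f /sector1 /=.
have yE x : c / a * r - b / a * x = (c * r - b * x) / a by field; rewrite gt_eqF.
under eq_integral => x _.
  rewrite (_ : x / a + (c / a * r - b / a * x) / b = r / h); last first.
    by rewrite /h; field; rewrite !gt_eqF.
  rewrite yE [0 <= _ / a]pmulr_lge0 ?invr_gt0//.
  over.
(* [r] and [(c * x - b * r) / a] are orthonormal coordinates of the point (x, y), the second one
   measured from the foot along the chord. *)
have diskE x : (x ^+ 2 + ((c * r - b * x) / a) ^+ 2 <= t ^+ 2) =
    (((c * x - b * r) / a) ^+ 2 <= t ^+ 2 - r ^+ 2).
  rewrite lerBrDr (_ : _ + r ^+ 2 = x ^+ 2 + ((c * r - b * x) / a) ^+ 2)//.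
  rewrite !expr_div_n !sqrrB !exprMn cab; field.
  by rewrite gt_eqF.
case: (leP 0 r) => r0 /=; last first.
  rewrite integral0_eq ?mule0// => x _; case: ifP => // /and3P[x0 H _].
  exfalso; move: H; rewrite subr_ge0 leNgt (lt_le_trans _ (_ : 0 <= _))//.
    by rewrite pmulr_rlt0.
  by rewrite mulr_ge0// ltW.
have mS : measurable_fun setT ((fun x => [&& 0 <= x, 0 <= c * r - b * x
    & x ^+ 2 + ((c * r - b * x) / a) ^+ 2 <= t ^+ 2]) : measurableTypeR R -> bool).
  repeat apply: measurable_and; apply: measurable_fun_ler => //.
    by apply: measurable_funB => //; exact: measurable_funM.
  apply: measurable_funD; apply: measurable_funX => //; apply: measurable_funM => //.
  by apply: measurable_funB => //; exact: measurable_funM.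
rewrite integral_if_cst ?sqr_ge0//.
(* [m1] and [m2] are the lengths of the chord on the two sides of the foot, bounded by [y = 0] and
   [x = 0] respectively, or by the circle. *)
set q := Num.sqrt _; set m1 := Num.min (a / b * r) q; set m2 := Num.min (b / a * r) q.
have m10 : 0 <= m1 by rewrite /m1 /q mn0// divr_ge0 ?ltW.
have m20 : 0 <= m2 by rewrite /m2 /q mn0// divr_ge0 ?ltW.
have lc : (b * r - a * m2) / c <= (b * r + a * m1) / c.
  rewrite ler_pM2r ?invr_gt0//.
  have := mulr_ge0 (ltW a0) m10; have := mulr_ge0 (ltW a0) m20; lra.
rewrite (@lebesgue_measure_sandwich _ _ ((b * r - a * m2) / c) ((b * r + a * m1) / c))//.
- rewrite muleCA -!EFinM; congr (_ * _)%:E; field.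
  by rewrite !gt_eqF.
- exact: measurable_bool_set.
- move=> x /=; rewrite in_itv /= ltr_pdivrMr// ltr_pdivlMr// => /andP[H1 H2].
  have H3 : - m2 < (c * x - b * r) / a by rewrite ltr_pdivlMr//; lra.
  have H4 : (c * x - b * r) / a < m1 by rewrite ltr_pdivrMr//; lra.
  have m2q : m2 <= q by rewrite ge_min lexx orbT.
  have m1q : m1 <= q by rewrite ge_min lexx orbT.
  have m2r : a * m2 <= b * r.
    have : m2 <= b / a * r by rewrite ge_min lexx.
    by rewrite mulrAC ler_pdivlMr// [m2 * a]mulrC.
  have m1r : b * m1 <= a * r.
    have : m1 <= a / b * r by rewrite ge_min lexx.
    by rewrite mulrAC ler_pdivlMr// [m1 * b]mulrC.
  apply/and3P; split.
  + by rewrite -(pmulr_rge0 _ c0) mulrC; lra.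
  + rewrite -(pmulr_rge0 _ c0).
    have -> : c * (c * r - b * x) = a ^+ 2 * r + b * (b * r - c * x).
      by rewrite mulrBr !mulrA -expr2 cab; ring.
    have : b * (x * c) < b * (b * r + a * m1) by rewrite ltr_pM2l.
    have : a * (b * m1) <= a * (a * r) by rewrite ler_pM2l.
    lra.
  + rewrite diskE; apply: normr_lt_sqrt; rewrite -/q ltr_norml.
    by apply/andP; split; lra.
- move=> x /= /and3P[x0 y0]; rewrite diskE => /normr_le_sqrt.
  rewrite -/q ler_norml => /andP[H1 H2].
  rewrite in_itv /= ler_pdivrMr// ler_pdivlMr//; apply/andP; split.
  + rewrite lerBlDr -lerBlDl -ler_pdivrMl// le_min.
    apply/andP; split.
    * have -> : b / a * r = a^-1 * (b * r) by ring.
      by rewrite ler_pM2l ?invr_gt0// gerBl mulr_ge0// ltW.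
    * by move: H1; rewrite lerNl; apply: le_trans; lra.
  + rewrite -lerBlDl -ler_pdivrMl// le_min; apply/andP; split; last first.
      by apply: le_trans H2; lra.
    have -> : a / b * r = a^-1 * (a ^+ 2 * r / b) by field; rewrite !gt_eqF.
    rewrite ler_pM2l ?invr_gt0// ler_pdivlMr//.
    have : 0 <= c * (c * r - b * x) by rewrite mulr_ge0// ltW.
    have -> : c * (c * r - b * x) = a ^+ 2 * r - (x * c - b * r) * b.
      by rewrite mulrBr !mulrA -expr2 cab; ring.
    by rewrite subr_ge0.
Qed.

(** By central symmetry the integral is twice that over [x >= 0], where the three cones apply. *)
Lemma integral_ball_overlap a b c t : 0 < a -> 0 < b -> 0 < c ->
  c ^+ 2 = a ^+ 2 + b ^+ 2 -> let h := a * b / c in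
  (\int[mu]_x \int[mu]_y (ball_overlap a b t x y)%:E =
   2%:E * (sector_integral h (a / b) t + sector_integral h (b / a) t +
           sector_integral a (b / a) t + sector_integral b (a / b) t))%E.
Proof.
move=> a0 b0 c0 cab h.
have mB : measurable_fun setT (fun v : plane R => (ball_overlap a b t v.1 v.2)%:E).
  by apply/measurable_EFinP; exact: measurable_ball_overlap.
have B0 x y : (0 <= (ball_overlap a b t x y)%:E)%E.
  by rewrite lee_fin /ball_overlap; case: ifP => // _; rewrite sqr_ge0.
have mS1 : measurable_fun setT (fun v : plane R => (sector1 a b t v.1 v.2)%:E).
  by apply/measurable_EFinP; exact: measurable_sector1.
have mS2 : measurable_fun setT (fun v : plane R => (sector2 a b t v.1 v.2)%:E).
  by apply/measurable_EFinP; exact: measurable_sector2.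
have mS3 : measurable_fun setT (fun v : plane R => (sector3 a b t v.1 v.2)%:E).
  by apply/measurable_EFinP; exact: measurable_sector3.
pose m x := (\int[mu]_y (ball_overlap a b t x y)%:E)%E.
have mm : measurable_fun setT m.
  exact: (measurable_fun_fubini_tonelli_F (m2 := mu) _ mB (fun v => B0 v.1 v.2)).
have m0 x : (0 <= m x)%E by exact: integral_ge0.
(* The symmetry negates both coordinates, so [y] is negated under the inner integral as well. *)
have mN x : m (- x) = m x.
  rewrite /m -ge0_integral_opp//; last first.
    apply/measurable_EFinP.
    exact: (measurableT_comp (measurable_ball_overlap a b t) (pair1_measurable (- x))).
  by apply: eq_integral => y _; rewrite ball_overlapN.
have half : (\int[mu]_(x in `[0%R, +oo[) m x =
    sector_integral h (a / b) t + sector_integral h (b / a) t +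
    sector_integral a (b / a) t + sector_integral b (a / b) t)%E.
  rewrite -(integral_sector1 t a0 b0 c0 cab) -integral_sector2// -integral_sector3//.
  have meas1 (f : R -> R -> R) : measurable_fun setT (fun v : plane R => (f v.1 v.2)%:E) ->
      (forall x y, 0 <= f x y) ->
      measurable_fun setT (fun x => \int[mu]_y (f x y)%:E)%E.
    move=> mf f0; apply: (measurable_fun_fubini_tonelli_F (m2 := mu) _ mf).
    by move=> v; rewrite lee_fin.
  have pos (f : R -> R -> R) x : (forall x y, 0 <= f x y) -> (0 <= \int[mu]_y (f x y)%:E)%E.
    by move=> f0; apply: integral_ge0 => y _; rewrite lee_fin.
  have sec (f : R -> R -> R) x : measurable_fun setT (fun v : plane R => (f v.1 v.2)%:E) ->
      measurable_fun setT (fun y : measurableTypeR R => (f x y)%:E).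
    by move=> mf; exact: (measurableT_comp mf (pair1_measurable x)).
  have s1 := sector1_ge0 a b t; have s2 := sector2_ge0 a b t; have s3 := sector3_ge0 a b t.
  rewrite -ge0_integralD//; last 4 first.
  - by move=> x _; exact: pos.
  - exact: meas1.
  - by move=> x _; exact: pos.
  - exact: meas1.
  rewrite -ge0_integralD//; last 4 first.
  - by move=> x _; rewrite adde_ge0 ?pos.
  - by apply: emeasurable_funD; exact: meas1.
  - by move=> x _; exact: pos.
  - exact: meas1.
  rewrite [LHS]integral_mkcond; apply: eq_integral => x _.
  rewrite patchE mem_setE in_itv /= andbT; case: ifPn => x0.
    rewrite -!ge0_integralD//; try (by move=> y _; rewrite ?adde_ge0// lee_fin);
      try (by apply: emeasurable_funD; exact: sec); try exact: sec.
    by apply: eq_integral => y _; rewrite -!EFinD -ball_overlapE.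
  rewrite /sector1 /sector2 /sector3 (negbTE x0) /= !integral0 ?adde0//.
have TE : [set: R] = `]-oo, 0%R] `|` `]0%R, +oo[.
  by apply/seteqP; split => x //= _; rewrite !in_itv /= andbT; case: leP; [left|right].
transitivity (\int[mu]_(x in `]-oo, 0%R] `|` `]0%R, +oo[) m x)%E; first by rewrite -TE.
rewrite ge0_integral_setU//; last 2 first.
- exact: measurable_funTS mm.
- by apply/disj_setPS => x /=; rewrite !in_itv /= andbT => -[/le_lt_trans H /H]; rewrite ltxx.
rewrite integral_itv_obnd_cbnd; last exact: measurable_funTS mm.
have -> : (\int[mu]_(x in `]-oo, 0%R]) m x = \int[mu]_(x in `]-oo, 0%R]) m (- x)%R)%E.
  by apply: eq_integral => x _; rewrite mN.
rewrite -ge0_integration_by_substitution0// half.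
by rewrite -mule2n mule_natl.
Qed.

End total.

(** * Primitives of the sector integrals *)

Section sector_closed_form.
Context {R : realType}.
Notation mu := (@lebesgue_measure R).
Implicit Types (t r p k m x y z : R).

(* Gives the left continuity of [asin] at [1]. *)
Lemma asin_half x : -1 <= x <= 1 -> asin x = pi / 2 - 2 * asin (Num.sqrt ((1 - x) / 2)).
Proof.
move=> x1; set y := Num.sqrt _.
have y2 : y ^+ 2 = (1 - x) / 2 by rewrite sqr_sqrtr; lra.
have y0 : 0 <= y by rewrite sqrtr_ge0.
have y1 : y <= 1 by rewrite -(ler_pXn2r (_ : 0 < 2)%N) ?nnegrE// y2 expr1n; lra.
have yI : -1 <= y <= 1 by apply/andP; split; lra.
have ylo : 0 <= asin y.
  rewrite leNgt; apply/negP => H; have : sin (asin y) < 0.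
    rewrite -[asin y]opprK sinN oppr_lt0; apply: sin_gt0_pi.
    rewrite oppr_gt0 H /=; have /= := asin_geNpi2 yI; have := pi_gt0 R; lra.
  by rewrite asinK ?in_itv//= ltNge y0.
have yhi := asin_lepi2 yI.
rewrite -[LHS](_ : asin (sin (pi / 2 - 2 * asin y)) = _).
  by rewrite sinK// in_itv /=; apply/andP; split; lra.
congr asin; rewrite sinB sin_pihalf cos_pihalf mul0r subr0 mul1r mulr_natl.
by rewrite cos_mulr2n cos2sin2 asinK ?in_itv//= y2; lra.
Qed.

Lemma asin1 : asin 1 = pi / 2 :> R.
Proof.
have := @sinK R (pi / 2); rewrite sin_pihalf => -> //.
rewrite in_itv /= lexx andbT.
by have := pi_gt0 R; lra.
Qed.

(** Primitive of [(1 - r / p) ^+ 2 * Num.sqrt (t ^+ 2 - r ^+ 2)], obtained by expanding the square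
    and integrating the term in [r ^+ 2] by parts. *)
Definition cap_primitive (p t r : R) : R :=
  1 / 2 * (1 + t ^+ 2 / (4 * p ^+ 2)) *
    (r * Num.sqrt (t ^+ 2 - r ^+ 2) + t ^+ 2 * asin (r / t))
  + 2 / (3 * p) * Num.sqrt (t ^+ 2 - r ^+ 2) ^+ 3
  - 1 / (4 * p ^+ 2) * (r * Num.sqrt (t ^+ 2 - r ^+ 2) ^+ 3).

Lemma is_derive_chord t r : r ^+ 2 < t ^+ 2 ->
  is_derive r 1 (fun r => Num.sqrt (t ^+ 2 - r ^+ 2)) (- r / Num.sqrt (t ^+ 2 - r ^+ 2)).
Proof.
move=> rt; have D0 : 0 < t ^+ 2 - r ^+ 2 by rewrite subr_gt0.
have := is_derive1_sqrt D0 => d1.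
have d2 : is_derive r 1 (fun r => t ^+ 2 - r ^+ 2) (- (2 * r)).
  by apply: is_derive_eq; rewrite /GRing.scale /= ?mulr1 ?expr1; ring.
have := @is_derive1_comp _ Num.sqrt (fun r => t ^+ 2 - r ^+ 2) r _ _ d1 d2.
set w := Num.sqrt _; have w0 : 0 < w by rewrite sqrtr_gt0.
by move=> d; apply: (is_derive_eq d); field; rewrite gt_eqF.
Qed.

Lemma is_derive_arc t r : 0 < t -> 0 <= r -> r < t ->
  is_derive r 1 (fun r => asin (r / t)) (Num.sqrt (t ^+ 2 - r ^+ 2))^-1.
Proof.
move=> t0 r0 rt.
have rt1 : -1 < r / t < 1.
  by rewrite ltr_pdivrMr// mul1r rt andbT (@lt_le_trans _ _ 0) ?divr_ge0// ltW.
have d1 := is_derive1_asin rt1.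
have d2 : is_derive r 1 (fun r => r / t) t^-1.
  by apply: is_derive_eq; rewrite /GRing.scale /= ?mulr1; ring.
have := @is_derive1_comp _ (@asin R) (fun r => r / t) r _ _ d1 d2.
have -> : Num.sqrt (t ^+ 2 - r ^+ 2) = t * Num.sqrt (1 - (r / t) ^+ 2).
  rewrite -[t in t * _]gtr0_norm// -sqrtr_sqr -sqrtrM ?sqr_ge0//; congr Num.sqrt.
  by field; rewrite gt_eqF.
by move=> d; apply: (is_derive_eq d); rewrite invfM mulrC.
Qed.

Lemma is_derive_cap_primitive p t r : 0 < p -> 0 < t -> 0 <= r -> r < t ->
  is_derive r 1 (cap_primitive p t) ((1 - r / p) ^+ 2 * Num.sqrt (t ^+ 2 - r ^+ 2)).
Proof.
move=> p0 t0 r0 rt.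
have rt2 : r ^+ 2 < t ^+ 2 by rewrite ltr_pXn2r ?nnegrE ?(ltW t0).
have d1 := is_derive_chord rt2.
have d2 := is_derive_arc t0 r0 rt.
have w2 : Num.sqrt (t ^+ 2 - r ^+ 2) ^+ 2 = t ^+ 2 - r ^+ 2.
  by rewrite sqr_sqrtr// subr_ge0 ltW.
have w0 : 0 < Num.sqrt (t ^+ 2 - r ^+ 2) by rewrite sqrtr_gt0 subr_gt0.
rewrite /cap_primitive.
(* The chord and the arc become opaque functions with known derivatives, so that differentiation is
   purely formal. *)
pose w r := Num.sqrt (t ^+ 2 - r ^+ 2); pose As r := asin (r / t).
rewrite -/(w r) -/w in d1 w2 w0 *; rewrite -/As -/(w r) in d2.
suff : is_derive r 1 (fun r => 1 / 2 * (1 + t ^+ 2 / (4 * p ^+ 2)) *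
    (r * w r + t ^+ 2 * As r) + 2 / (3 * p) * w r ^+ 3
    - 1 / (4 * p ^+ 2) * (r * w r ^+ 3)) ((1 - r / p) ^+ 2 * w r) by [].
move: (w) (As) d1 d2 w2 w0 => {}w {}As d1 d2 w2 w0.
apply: is_derive_eq.
rewrite /GRing.scale /= ?mulr1 ?expr1.
have -> : t ^+ 2 = w r ^+ 2 + r ^+ 2 by rewrite w2 subrK.
by field; rewrite !gt_eqF.
Qed.

(** At [r = t] the argument of [asin] reaches 1. The half-angle form keeps the argument away from 1
    on the whole interval. *)
Lemma continuous_cap_primitive p t : 0 < t ->
  {within `[0, t], continuous (cap_primitive p t)}.
Proof.
move=> t0.
pose arc r := pi / 2 - 2 * asin (Num.sqrt ((1 - r / t) / 2)).
pose w r := Num.sqrt (t ^+ 2 - r ^+ 2).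
apply: (@subspace_eq_continuous _ _ _ (fun r =>
  1 / 2 * (1 + t ^+ 2 / (4 * p ^+ 2)) * (r * w r + t ^+ 2 * arc r)
  + 2 / (3 * p) * w r ^+ 3 - 1 / (4 * p ^+ 2) * (r * w r ^+ 3))).
  move=> r; rewrite inE /= in_itv /= => /andP[r0 rt].
  rewrite /cap_primitive /arc -/(w r) -asin_half//.
  rewrite ler_pdivrMr// mul1r rt andbT; have := divr_ge0 r0 (ltW t0); lra.
apply/subspace_continuousP => r; rewrite /= in_itv /= => /andP[r0 rt].
apply: cvg_within_filter.
have cw : w x @[x --> r] --> w r.
  apply: (@cvg_comp _ _ _ (fun x => t ^+ 2 - x ^+ 2) (@Num.sqrt R)).
    by apply: cvgB; [exact: cvg_cst|exact: exprn_continuous].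
  exact: sqrt_continuous.
have cw3 : w x ^+ 3 @[x --> r] --> w r ^+ 3.
  by apply: (@cvg_comp _ _ _ w (fun x => x ^+ 3) _ _ _ cw); exact: exprn_continuous.
have carc : arc x @[x --> r] --> arc r.
  apply: cvgB; first exact: cvg_cst.
  apply: cvgM; first exact: cvg_cst.
  apply: (@cvg_comp _ _ _ (fun x => Num.sqrt ((1 - x / t) / 2)) (@asin R)).
    apply: (@cvg_comp _ _ _ (fun x => (1 - x / t) / 2) (@Num.sqrt R)).
      apply: cvgM; [apply: cvgB; [exact: cvg_cst|]|exact: cvg_cst].
      by apply: cvgM; [exact: cvg_id|exact: cvg_cst].
    exact: sqrt_continuous.
  have rt0 : 0 <= r / t by rewrite divr_ge0// ltW.
  have rt1 : r / t <= 1 by rewrite ler_pdivrMr// mul1r.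
  apply: continuous_asin; apply/andP; split.
    by rewrite (lt_le_trans _ (sqrtr_ge0 _))// ltrN10.
  by rewrite -(ltr_pXn2r (_ : 0 < 2)%N) ?nnegrE ?sqrtr_ge0// expr1n sqr_sqrtr; lra.
apply: cvgB.
  apply: cvgD.
    apply: cvgM; first exact: cvg_cst.
    apply: cvgD; first by apply: cvgM => //; exact: cvg_id.
    by apply: cvgM => //; exact: cvg_cst.
  by apply: cvgM => //; exact: cvg_cst.
apply: cvgM; first exact: cvg_cst.
by apply: cvgM => //; exact: cvg_id.
Qed.

Lemma integral_cap p t x y : 0 < p -> 0 < t -> 0 <= x -> x <= y -> y <= t ->
  (\int[mu]_(r in `[x, y]) ((1 - r / p) ^+ 2 * Num.sqrt (t ^+ 2 - r ^+ 2))%:E =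
   (cap_primitive p t y - cap_primitive p t x)%:E)%E.
Proof.
move=> p0 t0 x0 xy yt; apply: (@integral_FTC _ _ (cap_primitive p t) _ _ xy).
- apply: continuous_subspaceT => r; apply: cvgM.
    apply: (@cvg_comp _ _ _ (fun x => 1 - x / p) (fun x => x ^+ 2)).
      apply: cvgB; first exact: cvg_cst.
      by apply: cvgM; [exact: cvg_id|exact: cvg_cst].
    exact: exprn_continuous.
  apply: (@cvg_comp _ _ _ (fun x => t ^+ 2 - x ^+ 2) (@Num.sqrt R)).
    by apply: cvgB; [exact: cvg_cst|exact: exprn_continuous].
  exact: sqrt_continuous.
- apply: (continuous_subspaceW _ (@continuous_cap_primitive p t t0)) => r /=.
  by rewrite !in_itv /= => /andP[xr ry]; rewrite (le_trans x0 xr) (le_trans ry yt).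
- move=> r; rewrite in_itv /= => /andP[xr ry].
  by apply: is_derive_cap_primitive => //; [exact: le_trans (ltW xr)|exact: lt_le_trans yt].
Qed.

Lemma integral_wedge p k y : 0 < p -> 0 <= y ->
  (\int[mu]_(r in `[0%R, y]) ((1 - r / p) ^+ 2 * (k * r))%:E =
   (k * (y ^+ 2 / 2 - 2 / 3 * y ^+ 3 / p + y ^+ 4 / (4 * p ^+ 2)))%:E)%E.
Proof.
move=> p0 y0.
pose F r := k * (r ^+ 2 / 2 - 2 / 3 * r ^+ 3 / p + r ^+ 4 / (4 * p ^+ 2)).
have dF r : is_derive r 1 F ((1 - r / p) ^+ 2 * (k * r)).
  apply: is_derive_eq; rewrite /GRing.scale /= ?mulr1 ?expr1; field.
  by rewrite gt_eqF.
rewrite (integral_FTC_cont y0 _ dF).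
  by congr _%:E; rewrite /F; field; rewrite gt_eqF.
move=> r; apply: cvgM.
  apply: (@cvg_comp _ _ _ (fun x => 1 - x / p) (fun x => x ^+ 2)).
    apply: cvgB; first exact: cvg_cst.
    by apply: cvgM; [exact: cvg_id|exact: cvg_cst].
  exact: exprn_continuous.
by apply: cvgM; [exact: cvg_cst|exact: cvg_id].
Qed.

Lemma ge0_integral_itv_split x y z (f : R -> R) :
  x <= y -> y <= z -> measurable_fun setT (f : measurableTypeR R -> measurableTypeR R) ->
  (forall r, x <= r -> 0 <= f r) ->
  (\int[mu]_(r in `[x, z]) (f r)%:E =
   \int[mu]_(r in `[x, y]) (f r)%:E + \int[mu]_(r in `[y, z]) (f r)%:E)%E.
Proof.
move=> xy yz mf f0.
have mfe : measurable_fun setT (fun r => (f r)%:E) by exact/measurable_EFinP.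
rewrite (@itv_bndbnd_setU _ _ _ (BRight y)) ?bnd_simp//.
rewrite ge0_integral_setU//.
- by rewrite integral_itv_obnd_cbnd//; exact: measurable_funTS mfe.
- exact: measurable_funTS mfe.
- move=> r /=; rewrite !in_itv /= lee_fin => -[/andP[xr _]|/andP[yr _]]; apply: f0 => //.
  by rewrite (le_trans xy)// ltW.
- apply/disj_setPS => r /=; rewrite !in_itv /= => -[/andP[_ H1] /andP[H2 _]].
  by move: (le_lt_trans H1 H2); rewrite ltxx.
Qed.

End sector_closed_form.

(** * Values of the sector integral in the three ranges of [t] *)

Section sector_values.
Context {R : realType}.
Notation mu := (@lebesgue_measure R).
Variables p k m : R.
Hypotheses (p0 : 0 < p) (k0 : 0 < k) (m0 : 0 < m) (mk : m ^+ 2 = 1 + k ^+ 2).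
Implicit Types (t r : R).

(** [k * r] is at most the half-chord exactly when [(1 + k ^+ 2) * r ^+ 2 <= t ^+ 2], that is
    [m * r <= t]; [p * m] is the hypotenuse of the piece. *)
Lemma min_wedge t r : 0 <= r -> m * r <= t ->
  Num.min (k * r) (Num.sqrt (t ^+ 2 - r ^+ 2)) = k * r.
Proof.
move=> r0 mrt; apply: min_l.
rewrite -[k * r]ger0_norm ?mulr_ge0 ?(ltW k0)//; apply: normr_le_sqrt.
have : (m * r) ^+ 2 <= t ^+ 2.
  have mr0 : 0 <= m * r by rewrite mulr_ge0// ltW.
  by rewrite ler_pXn2r ?nnegrE// (le_trans mr0).
by rewrite !exprMn mk; lra.
Qed.

Lemma min_chord t r : 0 <= t -> 0 <= r -> t <= m * r ->
  Num.min (k * r) (Num.sqrt (t ^+ 2 - r ^+ 2)) = Num.sqrt (t ^+ 2 - r ^+ 2).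
Proof.
move=> t0 r0 tmr; apply: min_r.
rewrite -[leRHS]ger0_norm ?mulr_ge0 ?(ltW k0)// -sqrtr_sqr; apply: ler_wsqrtr.
have : t ^+ 2 <= (m * r) ^+ 2.
  by rewrite ler_pXn2r ?nnegrE// mulr_ge0// ltW.
by rewrite !exprMn mk; lra.
Qed.

Lemma sector_integral_full t : p * m <= t ->
  sector_integral p k t = (k * p ^+ 2 / 12)%:E.
Proof.
move=> pmt; rewrite /sector_integral.
transitivity (\int[mu]_(r in `[0%R, p]) ((1 - r / p) ^+ 2 * (k * r))%:E)%E.
  apply: eq_integral => r; rewrite inE /= in_itv /= => /andP[r0 rp].
  by rewrite min_wedge// mulrC (le_trans _ pmt)// ler_pM2r.
rewrite integral_wedge ?(ltW p0)//; congr _%:E; field.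
by rewrite gt_eqF.
Qed.

Lemma m_gt1 : 1 < m.
Proof.
rewrite -(ltr_pXn2r (_ : 0 < 2)%N) ?nnegrE ?(ltW m0)// mk expr1n ltrDl.
by rewrite exprn_gt0.
Qed.

(* The part of the primitives coming from the breakpoint [r = t / m], where
   [k * r = Num.sqrt (t ^+ 2 - r ^+ 2)]. *)
Definition sector_tail t : R :=
  - (1 / 2 * (1 + t ^+ 2 / (4 * p ^+ 2)) * t ^+ 2 * asin m^-1)
  - 2 * k * t ^+ 3 / (3 * p * m) + k * t ^+ 4 / (8 * p ^+ 2 * m ^+ 2).

(** The range is cut at [t / m], where the side meets the circle, and at [e], beyond which nothing
    is left. It is used with [e = t] and with [e = p]. *)
Lemma sector_integral_split t e : 0 < t -> t <= m * e -> e <= t -> e <= p ->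
  (\int[mu]_(r in `[e, p]) ((1 - r / p) ^+ 2 *
     Num.min (k * r) (Num.sqrt (t ^+ 2 - r ^+ 2)))%:E = 0)%E ->
  sector_integral p k t = (cap_primitive p t e + sector_tail t)%:E.
Proof.
move=> t0 tme et ep vanish; rewrite /sector_integral.
have rho0 : 0 <= t / m by rewrite divr_ge0 ?ltW.
have rhoe : t / m <= e by rewrite ler_pdivrMr// mulrC.
have e0 : 0 <= e by exact: le_trans rhoe.
pose f r := (1 - r / p) ^+ 2 * Num.min (k * r) (Num.sqrt (t ^+ 2 - r ^+ 2)).
have mf := measurable_min_sqrt p k t.
have f0 r : 0 <= r -> 0 <= f r.
  by move=> r0; rewrite mulr_ge0 ?sqr_ge0// le_min sqrtr_ge0 mulr_ge0// ltW.
rewrite (@ge0_integral_itv_split _ 0 e p f)//.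
rewrite (@ge0_integral_itv_split _ 0 (t / m) e f)//.
rewrite {1}/f vanish.
have -> : (\int[mu]_(r in `[0%R, (t / m)%R]) (f r)%:E =
    \int[mu]_(r in `[0%R, (t / m)%R]) ((1 - r / p) ^+ 2 * (k * r))%:E)%E.
  apply: eq_integral => r; rewrite inE /= in_itv /= => /andP[r0 rt].
  by rewrite /f min_wedge// mulrC -ler_pdivlMr.
have -> : (\int[mu]_(r in `[(t / m)%R, e]) (f r)%:E =
    \int[mu]_(r in `[(t / m)%R, e]) ((1 - r / p) ^+ 2 * Num.sqrt (t ^+ 2 - r ^+ 2))%:E)%E.
  apply: eq_integral => r; rewrite inE /= in_itv /= => /andP[rt re].
  by rewrite /f min_chord ?(ltW t0) ?(le_trans rho0)// mulrC -ler_pdivrMr.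
rewrite integral_wedge// integral_cap// adde0 -EFinD; congr _%:E.
rewrite /cap_primitive /sector_tail.
(* Side and circle meet at the breakpoint, so the square root there is rational in [t], [k], [m]. *)
have -> : Num.sqrt (t ^+ 2 - (t / m) ^+ 2) = k * (t / m).
  have -> : t ^+ 2 - (t / m) ^+ 2 = (k * (t / m)) ^+ 2.
    rewrite [RHS]exprMn; have -> : k ^+ 2 = m ^+ 2 - 1 by rewrite mk addrC addKr.
    by field; rewrite gt_eqF.
  by rewrite sqrtr_sqr ger0_norm// mulr_ge0// ltW.
have -> : t / m / t = m^-1 by field; rewrite !gt_eqF.
have -> : (k * (t / m)) ^+ 3 = k * (m ^+ 2 - 1) * (t / m) ^+ 3.
  by rewrite mk addrC addKr; ring.
by field; rewrite !gt_eqF.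
Qed.

Lemma sector_integral_le t : 0 <= t -> t <= p -> sector_integral p k t =
  (1 / 2 * (1 + t ^+ 2 / (4 * p ^+ 2)) * t ^+ 2 * (pi / 2) + sector_tail t)%:E.
Proof.
(* [t = 0] is treated apart, since the primitive divides by [t]. *)
rewrite le_eqVlt => /predU1P[<- _|t0 tp].
  rewrite /sector_integral integral0_eq.
    by rewrite /sector_tail; congr _%:E; rewrite !expr0n /=; ring.
  move=> r; rewrite /= in_itv /= => /andP[r0 _].
  by rewrite min_chord ?mulr_ge0 ?(ltW m0)// ler0_sqrtr ?mulr0// expr0n /= sub0r oppr_le0 sqr_ge0.
rewrite (@sector_integral_split t t)//.
- congr _%:E; congr (_ + _); rewrite /cap_primitive subrr sqrtr0 divff ?gt_eqF//.
  by rewrite asin1 expr0n /=; ring.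
- by rewrite ler_peMl ?ltW// m_gt1.
(* Beyond [t] the argument of [Num.sqrt] is nonpositive, so its value is 0. *)
- apply: integral0_eq => r; rewrite /= in_itv /= => /andP[tr rp].
  have r0 : 0 <= r by rewrite (le_trans (ltW t0)).
  rewrite min_r ler0_sqrtr ?mulr0 ?mulr_ge0 ?(ltW k0)//;
    by rewrite subr_le0 ler_pXn2r ?nnegrE ?(ltW t0).
Qed.

Lemma sector_integral_ge t : p <= t -> t <= p * m -> sector_integral p k t =
  (1 / 2 * (1 + t ^+ 2 / (4 * p ^+ 2)) *
    (p * Num.sqrt (t ^+ 2 - p ^+ 2) + t ^+ 2 * asin (p / t))
   + 5 / (12 * p) * Num.sqrt (t ^+ 2 - p ^+ 2) ^+ 3 + sector_tail t)%:E.
Proof.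
move=> pt tpm; have t0 : 0 < t by exact: lt_le_trans pt.
rewrite (@sector_integral_split t p)//; last 2 first.
- by rewrite mulrC.
- by rewrite set_itv1 integral_set1.
(* The two cubic terms merge at [r = p]: 2/3 - 1/4 = 5/12. *)
congr _%:E; congr (_ + _); rewrite /cap_primitive; field.
by rewrite gt_eqF.
Qed.

End sector_values.

(** * Comparison with the formulas for J *)

Section triangle_formulas.
Context {R : realType}.
Implicit Types (t x p k m : R).

Lemma powR32 x : 0 <= x -> x `^ (3 / 2) = Num.sqrt x ^+ 3.
Proof.
move=> x0; rewrite mulrC powRrM powR12_sqrt// -powR_mulrn ?sqrtr_ge0//.
Qed.

Lemma L1n_sqrt t x : 0 <= x -> x <= t -> L1n t x =
  1 / 8 * (5 * x / 3 * Num.sqrt (t ^+ 2 - x ^+ 2) ^+ 3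
           + x ^+ 3 * Num.sqrt (t ^+ 2 - x ^+ 2) + t ^+ 4 * asin (x / t)).
Proof.
move=> x0 xt; rewrite /L1n powR32// subr_ge0 ler_pXn2r ?nnegrE//.
exact: le_trans xt.
Qed.

Lemma L2n_sqrt t x : 0 <= x -> x <= t -> L2n t x =
  1 / 3 * Num.sqrt (t ^+ 2 - x ^+ 2) ^+ 3
  + x / 2 * (x * Num.sqrt (t ^+ 2 - x ^+ 2) + t ^+ 2 * asin (x / t)).
Proof.
move=> x0 xt; rewrite /L2n powR32// subr_ge0 ler_pXn2r ?nnegrE//.
exact: le_trans xt.
Qed.

Lemma L_diag x : 0 < x -> [/\ L1s x x = x ^+ 2 * pi / 4, L2s x x = x * pi / 2,
  L1n x x = x ^+ 4 * pi / 16 & L2n x x = x ^+ 3 * pi / 4].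
Proof.
move=> x0; rewrite L1n_sqrt ?L2n_sqrt ?(ltW x0)// /L1s /L2s subrr sqrtr0.
rewrite divff ?gt_eqF// asin1; by split; field.
Qed.

Lemma L_eval t x w g : 0 <= x -> x <= t ->
  Num.sqrt (t ^+ 2 - x ^+ 2) = w -> asin (x / t) = g ->
  [/\ L1s t x = 1 / 2 * (x * w + t ^+ 2 * g), L2s t x = w + x * g,
      L1n t x = 1 / 8 * (5 * x / 3 * w ^+ 3 + x ^+ 3 * w + t ^+ 4 * g) &
      L2n t x = 1 / 3 * w ^+ 3 + x / 2 * (x * w + t ^+ 2 * g)].
Proof. by move=> x0 xt <- <-; rewrite L1n_sqrt// L2n_sqrt. Qed.

(** This is the value of [sector_integral] for [t <= p]; beyond [p] it serves as a formal
    continuation to be corrected. *)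
Definition sector_le p k m t : R :=
  1 / 2 * (1 + t ^+ 2 / (4 * p ^+ 2)) * t ^+ 2 * (pi / 2) + sector_tail p k m t.

(* What has to be added to [sector_le] once [t] exceeds the height [p]. *)
Definition sector_gap p t : R :=
  5 / 8 * p * Num.sqrt (t ^+ 2 - p ^+ 2)
  + 13 / (24 * p) * Num.sqrt (t ^+ 2 - p ^+ 2) ^+ 3
  + 1 / 2 * (1 + t ^+ 2 / (4 * p ^+ 2)) * t ^+ 2 * (asin (p / t) - pi / 2).

Lemma sector_integral_le_gap p k m t : 0 < p -> 0 < k -> 0 < m ->
  m ^+ 2 = 1 + k ^+ 2 -> p <= t -> t <= p * m ->
  sector_integral p k t = (sector_le p k m t + sector_gap p t)%:E.
Proof.
move=> p0 k0 m0 mk pt tpm; rewrite (sector_integral_ge p0 k0 m0 mk pt tpm).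
congr _%:E; rewrite /sector_le /sector_gap.
set w := Num.sqrt _; have w2 : w ^+ 2 = t ^+ 2 - p ^+ 2.
  rewrite sqr_sqrtr// subr_ge0 ler_pXn2r ?nnegrE ?(ltW p0)//.
  by rewrite (le_trans _ pt) ?ltW.
(* This substitution produces 5/8 = 1/2 + 1/8 and 13/24 = 1/8 + 5/12. *)
have -> : t ^+ 2 = w ^+ 2 + p ^+ 2 by rewrite w2 subrK.
by field; rewrite gt_eqF.
Qed.

(** * Angles and lengths in the triangle, and the functions K *)

Variables a b : R.
Hypotheses (a0 : 0 < a) (ab : a <= b).
Notation c := (hypotenuse a b).
Notation al := (alpha a b).
Notation h := (height a b).

Let b0 : 0 < b. Proof. exact: lt_le_trans ab. Qed.

Lemma hypotenuse_gt0 : 0 < c.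
Proof. by rewrite sqrtr_gt0 addr_gt0 ?exprn_gt0. Qed.

Lemma hypotenuse_sqr : c ^+ 2 = a ^+ 2 + b ^+ 2.
Proof. by rewrite sqr_sqrtr// addr_ge0 ?sqr_ge0. Qed.

Let c0 := hypotenuse_gt0.
Let cab := hypotenuse_sqr.

Lemma cos_alpha : cos al = b / c.
Proof.
rewrite /alpha cos_atan.
have -> : 1 + (a / b) ^+ 2 = (c / b) ^+ 2 by rewrite !expr_div_n cab; field; rewrite gt_eqF.
by rewrite sqrtr_sqr ger0_norm ?divr_ge0 ?ltW// invf_div.
Qed.

Lemma sin_alpha : sin al = a / c.
Proof.
have -> : sin al = tan al * cos al.
  by rewrite /tan divfK// cos_alpha gt_eqF// divr_gt0.
by rewrite cos_alpha /alpha atanK; field; rewrite !gt_eqF.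
Qed.

Lemma alpha_bounds : - (pi / 2) < al < pi / 2 /\ 0 <= al.
Proof.
rewrite /alpha atan_gtNpi2 atan_ltpi2; split => //.
rewrite leNgt; apply/negP => al0; have : sin al < 0.
  rewrite -[al]opprK sinN oppr_lt0; apply: sin_gt0_pi.
  rewrite oppr_gt0 al0 /=; have := atan_gtNpi2 (a / b); have := pi_gt0 R.
  rewrite -/(alpha a b); lra.
by rewrite sin_alpha ltNge divr_ge0// ltW.
Qed.

(** With its complement below, this evaluates [asin m^-1] in [sector_tail] for [m = c / a] and
    [m = c / b]. *)
Lemma asin_alpha : asin (a / c) = al.
Proof.
have [/andP[H1 H2] H3] := alpha_bounds.
by rewrite -sin_alpha sinK// in_itv /= !ltW.
Qed.

Lemma asin_alphaC : asin (b / c) = pi / 2 - al.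
Proof.
have [/andP[H1 H2] H3] := alpha_bounds.
have <- : sin (pi / 2 - al) = b / c.
  by rewrite sinB sin_pihalf cos_pihalf mul1r mul0r subr0 cos_alpha.
by rewrite sinK// in_itv /=; apply/andP; split; lra.
Qed.

Lemma heightE : h = a * b / c.
Proof. by rewrite /height cos_alpha mulrA. Qed.

Lemma height_gt0 : 0 < h.
Proof. by rewrite heightE divr_gt0 ?mulr_gt0. Qed.

Lemma height_le : h <= a.
Proof.
rewrite heightE ler_pdivrMr// ler_pM2l//.
by rewrite -(ler_pXn2r (_ : 0 < 2)%N) ?nnegrE ?(ltW b0) ?(ltW c0)// cab lerDr sqr_ge0.
Qed.

(** The height cuts the hypotenuse into segments of lengths [a ^+ 2 / c] and [b ^+ 2 / c]. *)
Lemma chord_a_h : Num.sqrt (a ^+ 2 - h ^+ 2) = a ^+ 2 / c.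
Proof.
have -> : a ^+ 2 - h ^+ 2 = (a ^+ 2 / c) ^+ 2.
  by rewrite heightE; field: cab; rewrite gt_eqF.
by rewrite sqrtr_sqr ger0_norm// divr_ge0 ?sqr_ge0 ?ltW.
Qed.

Lemma chord_b_h : Num.sqrt (b ^+ 2 - h ^+ 2) = b ^+ 2 / c.
Proof.
have -> : b ^+ 2 - h ^+ 2 = (b ^+ 2 / c) ^+ 2.
  by rewrite heightE; field: cab; rewrite gt_eqF.
by rewrite sqrtr_sqr ger0_norm// divr_ge0 ?sqr_ge0 ?ltW.
Qed.

Lemma arc_a_h : asin (h / a) = pi / 2 - al.
Proof.
by rewrite -asin_alphaC heightE; congr asin; field; rewrite !gt_eqF.
Qed.

Lemma arc_b_h : asin (h / b) = al.
Proof.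
by rewrite -asin_alpha heightE; congr asin; field; rewrite !gt_eqF.
Qed.

Notation A := (area a b).

(** The quadratic and cubic terms of the four sector values add up to [A * t ^+ 2 * pi / 2] and
    [- (u * t ^+ 3 / 3)], with [u] the perimeter. The last two terms cancel them, leaving the
    quartic with [Theta1]. *)
Lemma K1E t : K1 a b t =
  A * (sector_le h (a / b) (c / b) t + sector_le h (b / a) (c / a) t
       + sector_le a (b / a) (c / a) t + sector_le b (a / b) (c / b) t)
  - A * t ^+ 2 * pi / 2 + perimeter a b * t ^+ 3 / 3.
Proof.
rewrite /K1 /J1n /H1n /sector_le /sector_tail !invf_div asin_alpha asin_alphaC.
rewrite /Theta1 /area /perimeter heightE.
(* With angles and square roots as variables, a rational identity modulo [c ^+ 2 = a ^+ 2 + b ^+ 2]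
   remains. *)
move: (al) (c) c0 cab (pi : R) => g d d0 dab q.
by field: dab; rewrite !gt_eqF.
Qed.

(** Past [h], both pieces with height [h] acquire the same gap. *)
Lemma K2E t : h <= t -> K1 a b h + K2 a b t = K1 a b t + A * (2 * sector_gap h t).
Proof.
move=> ht; rewrite /K1 /K2 /J1s /J1n /J2n /H1s /H2s /H1n /H2n /Theta1 /Theta2 /Theta3.
have [-> -> -> ->] := L_diag height_gt0.
rewrite L1n_sqrt ?L2n_sqrt ?(ltW height_gt0)// /sector_gap /area heightE.
move: (asin _) (Num.sqrt _) => f w.
move: (al) (c) c0 cab (pi : R) => g d d0 dab q.
by field: dab; rewrite !gt_eqF.
Qed.

(** At [t = a] two things change: the piece with legs [h] and [a / b * h], whose hypotenuse is [a],
    is now covered entirely, and the piece with height [a] acquires its gap. [K2 a b t] is continued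
    formally beyond [a]. *)
Lemma K3E t : a <= t -> K2 a b a + K3 a b t = K2 a b t +
  A * (a / b * h ^+ 2 / 12 - (sector_le h (a / b) (c / b) t + sector_gap h t)
       + sector_gap a t).
Proof.
move=> at_; have ht : h <= t := le_trans height_le at_.
rewrite /K2 /K3 /J1s /J2s /J2n /J3n /H1s /H2s /H3s /H2n /H3n.
rewrite /Theta1 /Theta2 /Theta3 /Theta4.
have [-> -> -> ->] := L_diag height_gt0.
have [-> -> -> ->] := L_diag a0.
have [-> -> -> ->] := L_eval (ltW height_gt0) height_le chord_a_h arc_a_h.
rewrite (L1n_sqrt (ltW height_gt0) ht) (L2n_sqrt (ltW height_gt0) ht).
rewrite (L1n_sqrt (ltW a0) at_) (L2n_sqrt (ltW a0) at_).
rewrite /sector_gap /sector_le /sector_tail !invf_div asin_alphaC /area heightE.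
move: (asin (a / t)) (Num.sqrt (t ^+ 2 - a ^+ 2)) => f w.
move: (asin _) (Num.sqrt _) => f' w'.
move: (al) (c) c0 cab (pi : R) => g d d0 dab q.
by field: dab; rewrite !gt_eqF.
Qed.

(** At [t = b] the other piece with height [h] is covered entirely and the piece with height [b]
    acquires its gap. *)
Lemma K4E t : b <= t -> K3 a b b + K4 a b t = K3 a b t +
  A * (b / a * h ^+ 2 / 12 - (sector_le h (b / a) (c / a) t + sector_gap h t)
       + sector_gap b t).
Proof.
move=> bt; have at_ : a <= t := le_trans ab bt.
have hb := le_trans height_le ab.
have ht : h <= t := le_trans hb bt.
rewrite /K3 /K4 /J1s /J2s /J3s /J3n /J4n /H3s /H4s /H3n /H4n.
rewrite /Theta3 /Theta4 /Theta5 /Theta6.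
have [-> -> -> ->] := L_diag b0.
have [-> -> -> ->] := L_eval (ltW height_gt0) hb chord_b_h arc_b_h.
rewrite (L1n_sqrt (ltW height_gt0) ht) (L2n_sqrt (ltW height_gt0) ht).
rewrite (L1n_sqrt (ltW b0) bt) (L2n_sqrt (ltW b0) bt).
rewrite /sector_gap /sector_le /sector_tail !invf_div asin_alpha /area heightE.
(* What is generalised in these three lines cancels, being common to [K3] and [K4] or to [H3] and
   [H4]. *)
move: (H1s _ _ _) (H1s _ _ _) (H2s _ _ _) (H2s _ _ _) => e1 e2 e3 e4.
move: (L1n b a) (L2n b a) (L1s b a) (L2s b a) (L1n t a) (L2n t a) => l1 l2 l3 l4 l5 l6.
move: (L1n _ _) (L2n _ _) (L1s _ _) (L2s _ _) => l7 l8 l9 l10.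
move: (asin (b / t)) (Num.sqrt (t ^+ 2 - b ^+ 2)) => f w.
move: (asin _) (Num.sqrt _) => f' w'.
move: (al) (c) c0 cab (pi : R) => g d d0 dab q.
by field: dab; rewrite !gt_eqF.
Qed.

End triangle_formulas.

(** * Assembly of the distribution function over the ranges of [t] *)

Theorem corollary1 (R : realType) (a b : R) (ha : 0 < a) (hab : a <= b)
    (d : measure_display) (Omega : measurableType d) (P : probability Omega R)
    (X Y : {RV P >-> plane R})
    (hX : uniformly_distributed X (right_triangle a b))
    (hY : uniformly_distributed Y (right_triangle a b))
    (hXY : independent_points X Y) (t : R) :
  let c := hypotenuse a b in
  let u := perimeter a b in
  let A := area a b in
  distance_distribution X Y t =
  (if t < 0 then 0
   else if t < c then
     1 / A * (t ^+ 2 * (pi - 2 * u / (3 * A) * t) + 2 / A * Jnat a b t)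
   else 1)%:E.
Proof.
move=> c u A.
have hb : 0 < b := lt_le_trans ha hab.
case: ltP => t0.
  rewrite /distance_distribution [X in P X](_ : _ = set0) ?measure0//.
  apply/seteqP; split => // w /=.
  by move=> /(le_trans (sqrtr_ge0 _)); rewrite leNgt t0.
case: ltP => tc; last exact: (distance_distribution_ge_hypotenuse ha hb tc).
have c0 : 0 < c := hypotenuse_gt0 ha hab.
have cab : c ^+ 2 = a ^+ 2 + b ^+ 2 := hypotenuse_sqr a b.
have h0 := height_gt0 ha hab.
have A0 : 0 < A by rewrite divr_gt0 ?mulr_gt0.
rewrite (distance_distributionE ha hb t0 hX hY hXY).
rewrite (integral_ball_overlap t ha hb c0 cab) -heightE//.
set h := height a b in h0 *.
have ab0 : 0 < a / b by rewrite divr_gt0.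
have ba0 : 0 < b / a by rewrite divr_gt0.
have cb0 : 0 < c / b by rewrite divr_gt0.
have ca0 : 0 < c / a by rewrite divr_gt0.
have mab : (c / b) ^+ 2 = 1 + (a / b) ^+ 2.
  by rewrite !expr_div_n cab; field; rewrite gt_eqF.
have mba : (c / a) ^+ 2 = 1 + (b / a) ^+ 2.
  by rewrite !expr_div_n cab; field; rewrite gt_eqF.
(* The hypotenuses [p * m] of the four pieces are the sides [a], [b], [c], [c]; they are the
   thresholds for full coverage. *)
have hcb : h * (c / b) = a by rewrite /h heightE// -/c; field; rewrite !gt_eqF.
have hca : h * (c / a) = b by rewrite /h heightE// -/c; field; rewrite !gt_eqF.
have aca : a * (c / a) = c by field; rewrite gt_eqF.
have bcb : b * (c / b) = c by field; rewrite gt_eqF.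
have ha_ : h <= a := height_le ha hab.
pose full k := k * h ^+ 2 / 12.
(* The claimed formula is solved for [Jnat]; only the four sector values depend on the range of
   [t]. *)
suff [s1 [s2 [s3 [s4 [-> -> -> -> JE]]]]] : exists s1 s2 s3 s4 : R, [/\
    sector_integral h (a / b) t = s1%:E, sector_integral h (b / a) t = s2%:E,
    sector_integral a (b / a) t = s3%:E, sector_integral b (a / b) t = s4%:E &
    Jnat a b t = A * (s1 + s2 + s3 + s4) - A * t ^+ 2 * pi / 2 + u * t ^+ 3 / 3].
  rewrite -!EFinD -!EFinM JE; congr _%:E; rewrite -/A; field.
  by rewrite gt_eqF.
rewrite /Jnat /= -/h; case: (ltP t h) => th.
  have ta := le_trans (ltW th) ha_; have tb := le_trans ta hab.
  rewrite (sector_integral_le h0 ab0 cb0 mab t0 (ltW th)).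
  rewrite (sector_integral_le h0 ba0 ca0 mba t0 (ltW th)).
  rewrite (sector_integral_le ha ba0 ca0 mba t0 ta).
  rewrite (sector_integral_le hb ab0 cb0 mab t0 tb).
  by do 4 eexists; split => //; rewrite K1E.
have gh k m := sector_integral_le_gap h0 (k := k) (m := m) (t := t).
case: (ltP t a) => ta.
  have tb := le_trans (ltW ta) hab.
  rewrite (gh _ _ ab0 cb0 mab th) ?hcb ?(ltW ta)//.
  rewrite (gh _ _ ba0 ca0 mba th) ?hca//.
  rewrite (sector_integral_le ha ba0 ca0 mba t0 (ltW ta)).
  rewrite (sector_integral_le hb ab0 cb0 mab t0 tb).
  do 4 eexists; split => //; rewrite (K2E ha hab th) (K1E ha hab) -/A -/u -/c -/h.
  rewrite /sector_le; ring.
have f1 : sector_integral h (a / b) t = (full (a / b))%:E.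
  by rewrite (sector_integral_full h0 ab0 cb0 mab) ?hcb.
have g3 : sector_integral a (b / a) t =
    (sector_le a (b / a) (c / a) t + sector_gap a t)%:E.
  by apply: sector_integral_le_gap => //; rewrite aca ltW.
case: (ltP t b) => tb.
  rewrite f1 (gh _ _ ba0 ca0 mba th) ?hca ?(ltW tb)// g3.
  rewrite (sector_integral_le hb ab0 cb0 mab t0 (ltW tb)).
  do 4 eexists; split => //; rewrite -addrA (K3E ha hab ta) addrA (K2E ha hab th).
  rewrite (K1E ha hab) -/A -/u -/c -/h /sector_le /full; ring.
have f2 : sector_integral h (b / a) t = (full (b / a))%:E.
  by rewrite (sector_integral_full h0 ba0 ca0 mba) ?hca.
have g4 : sector_integral b (a / b) t =
    (sector_le b (a / b) (c / b) t + sector_gap b t)%:E.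
  by apply: sector_integral_le_gap => //; rewrite bcb ltW.
rewrite f1 f2 g3 g4.
do 4 eexists; split => //.
have -> : K1 a b h + K2 a b a + K3 a b b + K4 a b t =
    K1 a b h + K2 a b a + (K3 a b b + K4 a b t) by ring.
rewrite (K4E ha hab tb) addrA -[K1 a b h + _ + _]addrA (K3E ha hab ta) addrA (K2E ha hab th).
rewrite (K1E ha hab) -/A -/u -/c -/h /full; ring.
Qed.
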